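(* Let $(b,\theta,q,m)$ be a magnetic graph over $X$ such that $q\in\mathcal{K}_{\alpha}^{p,\theta}$ for some $\alpha\in(0,1)$ and $p\in[1,\infty)$. The following assertions are equivalent: (i) There are $a,k\ge 0$ such that the magnetic graph is $(a,k)_1$-magnetic-sparse. (i') There are $a',k'\ge 0$ such that the magnetic graph is $(a',k')_p$-magnetic-sparse. (ii) There are $\tilde a\in(0,1)$ and $\tilde k\ge 0$ such that for all $f\in C_c(X)$ $$(1-\tilde a)\langle \mathrm{Deg},|f|^p\rangle-\tilde k\|f\|_p^p\le Q_{p,\theta}(f).$$ Moreover, for $p=2$, i.e., $q\in\mathcal{K}_{\alpha}^{2,\theta}$, the assertions (i), (i') and (ii) are also equivalent to: (iii) $D(Q_\theta)=\ell^2(X,\deg^{(+)})\cap \ell^2(X,m)$, where $\deg^{(+)}=\deg+q_-m$. In (i') the constant $a'$ can be chosen in dependence of $a$ and $k$ given in (i) and $\alpha$ such that $$a'=\frac{2^{1-p}(p^2+1)^{p/2}(1+a)^p-\alpha}{1-\alpha}$$ and $k'$ is a constant such that $k'=0$ if $k=0$ and $q\ge 0$. In (ii) the constant $\tilde a$ can be chosen in dependence of $a$ and $k$ given in (i) and $\alpha$ such that $$\tilde a=1-\frac{1-\alpha}{2^{1-p}(p^2+1)^{p/2}(1+a)^p-\alpha}$$ and $\tilde k$ is a constant such that $\tilde k=0$ if $k=0$ and $q\ge 0$.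
   Context: Let $X$ be a discrete set and $C_c(X)$ the space of complex-valued functions on $X$ with finite support. A magnetic graph $(b,\theta,q,m)$ over $X$ consists of: a symmetric function $b:X\times X\to[0,\infty)$ with zero diagonal and $\sum_{y\in X}b(x,y)<\infty$ for all $x\in X$ (the graph); an antisymmetric function $\theta:X\times X\to\mathbb{R}/2\pi\mathbb{Z}$ (the magnetic potential); a function $q:X\to\mathbb{R}$ (the potential), with $q_\pm=(\pm q)\vee 0$; and a function $m:X\to(0,\infty)$ (the measure). For $p\in[1,\infty)$, $\|f\|_p=(\sum_{x}|f(x)|^pm(x))^{1/p}$ is the norm of $\ell^p(X,m)$. For $f\in C_c(X)$ and $g:X\to\mathbb{C}$, $\langle g,f\rangle=\sum_{x\in X}g(x)f(x)m(x)$. Energy functional: for $f\in C_c(X)$, $$Q_{p,\theta}(f)=Q_{p,b,\theta,q,m}(f)=\frac12\sum_{x,y\in X}b(x,y)|f(x)-e^{i\theta(x,y)}f(y)|^p+\sum_{x\in X}q(x)|f(x)|^pm(x).$$ For $\alpha>0$, $q\in\mathcal{K}_\alpha^{p,\theta}$ means that there is $C_\alpha\ge 0$ with $\langle q_-,|f|^p\rangle\le\alpha Q_{p,b,\theta,q_+,m}(f)+C_\alpha\|f\|_p^p$ for all $f\in C_c(X)$. For $p=2$ and $q\in\mathcal{K}_\alpha^{2,\theta}$ with $\alpha\in(0,1)$, the form $Q_{2,\theta}$ on $C_c(X)$ is closable in $\ell^2(X,m)$; its closure is denoted by $Q_\theta$, with domain $D(Q_\theta)$. Weighted degrees: $\mathrm{Deg}(x)=\frac1{m(x)}\sum_{y\in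 X}b(x,y)+q(x)$ and $\deg(x)=\sum_{y\in X}b(x,y)+q(x)m(x)$. For a non-negative function $w$ on $X$, $\ell^2(X,w)$ is the set of $f:X\to\mathbb{C}$ with $\sum_x|f(x)|^2w(x)<\infty$. Frustration index: for finite $W\subseteq X$ and $\mathbb{T}=\{z\in\mathbb{C}:|z|=1\}$, $$\iota_{p,\theta}(W)=\min_{\tau:W\to\mathbb{T}}\frac12\sum_{x,y\in W}b(x,y)|\tau(x)-e^{i\theta(x,y)}\tau(y)|^p.$$ A non-negative function $g$ on a discrete set is extended to subsets by $g(A)=\sum_{x\in A}g(x)$; $\partial W=(W\times(X\setminus W))\cup((X\setminus W)\times W)$. For $a,k\ge 0$, the magnetic graph is $(a,k)_p$-magnetic-sparse if for all finite $W\subseteq X$ $$b(W\times W)\le(1+a)\iota_{p,\theta}(W)+a\Big(\tfrac12 b(\partial W)+(q_+m)(W)\Big)+k\,m(W).$$ *)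

(* Defs.v *)
From HB Require Import structures.
From mathcomp Require Import all_boot all_order all_algebra.
From mathcomp Require Import all_classical all_reals all_analysis.
From mathcomp Require Import complex.

Set Implicit Arguments.
Unset Strict Implicit.
Unset Printing Implicit Defensive.

Import Order.TTheory GRing.Theory Num.Theory.
Import numFieldNormedType.Exports.

Local Open Scope classical_set_scope.
Local Open Scope ring_scope.

(* [magnetic_potential] takes values in representatives of R / 2 pi Z:
   antisymmetry is required modulo 2 pi only, and the potential is used below
   only through [expi]. *)
Record magnetic_graph (R : realType) (X : choiceType) := MagneticGraph {
  edge_weight : X -> X -> R;
  magnetic_potential : X -> X -> R;
  potential : X -> R;
  vertex_measure : X -> R;
  edge_weight_ge0 : forall x y, 0 <= edge_weight x y;
  edge_weight_sym : forall x y, edge_weight x y = edge_weight y x;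
  edge_weight_diag : forall x, edge_weight x x = 0;
  edge_weight_summable : forall x,
    (\esum_(y in [set: X]) (edge_weight x y)%:E < +oo)%E;
  magnetic_potential_antisym : forall x y, exists n : int,
    magnetic_potential y x = - magnetic_potential x y + n%:~R * (2 * pi);
  vertex_measure_gt0 : forall x, 0 < vertex_measure x
}.

Definition with_potential (R : realType) (X : choiceType)
    (G : magnetic_graph R X) (q : X -> R) : magnetic_graph R X :=
  MagneticGraph q (edge_weight_ge0 G) (edge_weight_sym G) (edge_weight_diag G)
    (edge_weight_summable G) (magnetic_potential_antisym G)
    (vertex_measure_gt0 G).

(* The real-valued modulus of a complex number ([`|z|] lives in R[i]). *)
Definition cmod (R : realType) (z : R[i]) : R := ComplexField.Normc.normc z.

Definition expi (R : realType) (t : R) : R[i] := Complex (cos t) (sin t).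

Definition modpow (R : realType) (X : Type) (p : R) (f : X -> R[i]) : X -> R :=
  fun x => cmod (f x) `^ p.

Section MagneticGraph.
Context (R : realType) (X : choiceType).
Implicit Types (G : magnetic_graph R X) (p : R) (f : X -> R[i]).

Definition Cc : set (X -> R[i]) :=
  [set f | finite_set [set x | f x != 0]].

(* Only pairings of real-valued functions are needed.  The sum is the library
   sum over the support of the summand, which is finite when [f] has finite
   support. *)
Definition pairing G (g f : X -> R) : R :=
  \sum_(x \in [set: X]) g x * f x * vertex_measure G x.

Definition lpnorm G p f : \bar R :=
  ((\esum_(x in [set: X]) (modpow p f x * vertex_measure G x)%:E) `^ p^-1)%E.

(* Q_{p, theta}.  It is finite on [Cc]; the non-negative double sum is
   left extended real. *)
Definition energy G p f : \bar R :=
  ((2^-1)%R%:E * (\esum_(z in [set: X * X])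
     (edge_weight G z.1 z.2 *
      cmod (f z.1 - expi (magnetic_potential G z.1 z.2) * f z.2) `^ p)%:E)
   + (pairing G (potential G) (modpow p f))%:E)%E.

(* The class K_alpha^{p, theta}, as a condition on the potential of [G]. *)
Definition form_small G p (alpha : R) : Prop :=
  exists2 C : R, 0 <= C & forall f, Cc f ->
    ((pairing G ((potential G)^\-)%R (modpow p f))%:E <=
     alpha%:E * energy (with_potential G ((potential G)^\+)%R) p f
     + C%:E * lpnorm G p f `^ p)%E.

(* sum_y b(x, y), finite by [edge_weight_summable] *)
Definition total_weight G (x : X) : R :=
  fine (\esum_(y in [set: X]) (edge_weight G x y)%:E)%E.

Definition Deg G (x : X) : R :=
  (vertex_measure G x)^-1 * total_weight G x + potential G x.

Definition deg G (x : X) : R :=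
  total_weight G x + potential G x * vertex_measure G x.

Definition deg_plus G (x : X) : R :=
  deg G x + (potential G)^\- x * vertex_measure G x.

Definition ell2 (w : X -> R) : set (X -> R[i]) :=
  [set f | (\esum_(x in [set: X]) (cmod (f x) ^+ 2 * w x)%:E < +oo)%E].

(* The domain of the closure in l^2(X, m) of the form Q_{2, theta} on [Cc]:
   the l^2-limits of sequences of [Cc] that are Cauchy for the form. *)
Definition form_domain G : set (X -> R[i]) :=
  [set f | ell2 (vertex_measure G) f /\
    exists F : nat -> X -> R[i],
      [/\ forall n, Cc (F n),
          lpnorm G 2 (F n \- f) @[n --> \oo] --> 0%E &
          energy G 2 (F nk.1 \- F nk.2)
            @[nk --> filter_prod \oo \oo] --> 0%E]].

(* The minimum over W -> T, attained by compactness.  The values of [tau]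
   outside W do not matter. *)
Definition frustration_index G p (W : set X) : R :=
  inf [set 2^-1 * \sum_(x \in W) \sum_(y \in W) edge_weight G x y *
             cmod (tau x - expi (magnetic_potential G x y) * tau y) `^ p
      | tau in [set tau : X -> R[i] | forall x, W x -> cmod (tau x) = 1]].

Definition boundary (W : set X) : set (X * X) :=
  (W `*` (~` W)) `|` ((~` W) `*` W).

(* The extension g(A) of a non-negative function g to sets. *)
Definition mass (T : choiceType) (g : T -> R) (A : set T) : \bar R :=
  (\esum_(x in A) (g x)%:E)%E.

Definition magnetic_sparse G p (a k : R) : Prop :=
  forall W : set X, finite_set W ->
    (mass (fun z => edge_weight G z.1 z.2) (W `*` W) <=
     (1 + a)%:E * (frustration_index G p W)%:E
     + a%:E * ((2^-1)%R%:E * mass (fun z => edge_weight G z.1 z.2) (boundary W)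
               + mass (fun x => ((potential G)^\+ x * vertex_measure G x)%R) W)
     + k%:E * mass (vertex_measure G) W)%E.

Definition Deg_bound G p (a k : R) : Prop :=
  forall f, Cc f ->
    (((1 - a) * pairing G (Deg G) (modpow p f))%:E
       - k%:E * lpnorm G p f `^ p <= energy G p f)%E.

End MagneticGraph.

(* Main.v *)
Require Import Defs.
From mathcomp Require Import all_boot all_order all_algebra.
From mathcomp Require Import all_classical all_reals all_analysis.
From mathcomp Require Import complex ring lra finmap.

Set Implicit Arguments.
Unset Strict Implicit.
Unset Printing Implicit Defensive.

Import Order.TTheory GRing.Theory Num.Theory.
Import numFieldNormedType.Exports.

Local Open Scope classical_set_scope.
Local Open Scope ring_scope.

(**
The whole theorem rests on two-sided comparisons of the energy with the weighted
degree. For [f] of finite support write [P] for the energy with potential [q_+],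
[M] for the pairing of [q_-] with [|f|^p], [N] for the [p]-th power of the norm and
[S] for the pairing of [|f|^p] with the degree formed with [q_+]. The energy is
[P - M], and [M <= alpha P + C N] by hypothesis.

From (i) to a lower bound. Let [f = |f| tau] with [tau] unimodular. Sparseness of a
superlevel set of [|f|^p], where the frustration index is estimated by the value at
[tau], bounds the degree of that set by the jumps and twists of its indicator. These
inequalities add up, as in the coarea formula, to [deg_le_coarea_energy]: the degree
form is at most [1 + a] times the sum over the edges of
[ | |f(x)|^p - |f(y)|^p | + min(|f(x)|^p, |f(y)|^p) |tau(x) - e tau(y)| ].
Such a term is compared with [|f(x) - e f(y)|^p] edge by edge in [coarea_edge_le]:
the polar formula for the distance and the Cauchy-Schwarz inequality give the factor
[sqrt (p^2 + 1)], the midpoint inequality [powR_sub_le] gives the power of two, and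
Young's inequality separates the gradient from the vertex terms. The result,
[deg_norm_le_of_sparse], is [S <= D P + p k N] with [D] the constant of the theorem.
Young's inequality applied on each edge gives the same constant as Hoelder's
inequality for the whole sum followed by Bernoulli's inequality.

The lower bound (ii) then follows from the smallness of [q_-] by a convex
combination ([Deg_bound_of_deg_norm_le]).

From (ii) to (i'), one tests with the functions that are unimodular on [W] and
vanish elsewhere ([sparse_of_Deg_bound]); from (i') to (i), one uses that distances
of unimodular numbers are at most 2 ([magnetic_sparse1]).

For [p = 2], (ii) says that [S <= K (P + N)] on functions of finite support for some
[K]. Since [P <= 4 S] always, this bound makes the form norm equivalent to the norm of
the weighted [l^2] space, in which finitely supported functions are dense, and (iii)
follows ([form_domain_sub], [ell2_sub_form_domain]). Conversely, if no such [K]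
exists, then a gliding hump argument produces an element of the form domain that is
not in the weighted space ([unbounded_form_domain]).
*)

(** * The modulus of complex numbers *)

Section Modulus.
Context {R : realType}.
Implicit Types z w : R[i].

Lemma cmodE (a b : R) : cmod (Complex a b) = Num.sqrt (a ^+ 2 + b ^+ 2).
Proof. by []. Qed.

Lemma cmod_ge0 z : 0 <= cmod z.
Proof. by case: z => a b; rewrite cmodE sqrtr_ge0. Qed.

Lemma sqr_cmod (a b : R) : cmod (Complex a b) ^+ 2 = a ^+ 2 + b ^+ 2.
Proof. by rewrite cmodE sqr_sqrtr// addr_ge0// sqr_ge0. Qed.

Lemma cmodM z w : cmod (z * w) = cmod z * cmod w.
Proof. exact: ComplexField.Normc.normcM. Qed.

Lemma cmod0 : cmod (0 : R[i]) = 0.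
Proof. exact: ComplexField.Normc.normc0. Qed.

Lemma cmod1 : cmod (1 : R[i]) = 1.
Proof. exact: ComplexField.Normc.normc1. Qed.

Lemma cmod_eq0 z : (cmod z == 0) = (z == 0).
Proof.
apply/eqP/eqP => [|->]; last exact: cmod0.
exact: ComplexField.Normc.eq0_normc.
Qed.

Lemma le_cmodD z w : cmod (z + w) <= cmod z + cmod w.
Proof. by case: z => a b; case: w => c d; exact: le_normcD. Qed.

Lemma cmodN z : cmod (- z) = cmod z.
Proof. by case: z => a b; rewrite [LHS]cmodE !sqrrN. Qed.

Lemma cmod_distC z w : cmod (z - w) = cmod (w - z).
Proof. by rewrite -opprB cmodN. Qed.

Lemma cmod_real (t : R) : cmod (Complex t 0) = `|t|.
Proof. by rewrite cmodE expr0n addr0 sqrtr_sqr. Qed.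

Lemma cmod_expi (t : R) : cmod (expi t) = 1.
Proof. by rewrite /expi cmodE cos2Dsin2 sqrtr1. Qed.

Lemma sqr_cmodD_le z w : cmod (z + w) ^+ 2 <= 2 * cmod z ^+ 2 + 2 * cmod w ^+ 2.
Proof.
apply: (@le_trans _ _ ((cmod z + cmod w) ^+ 2)).
  by rewrite ler_pXn2r ?nnegrE ?addr_ge0 ?cmod_ge0// le_cmodD.
by have := sqr_ge0 (cmod z - cmod w); nra.
Qed.

(** The value [1] at [0] makes every function a product of its modulus and a
    unimodular function. *)
Definition phase z : R[i] := if z == 0 then 1 else Complex (cmod z)^-1 0 * z.

Lemma cmod_phase z : cmod (phase z) = 1.
Proof.
rewrite /phase; case: ifPn => [_|z0]; first exact: cmod1.
rewrite cmodM cmod_real ger0_norm ?invr_ge0 ?cmod_ge0// mulVf//.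
by rewrite cmod_eq0.
Qed.

Lemma phaseK z : Complex (cmod z) 0 * phase z = z.
Proof.
rewrite /phase; case: ifPn => [/eqP->|z0].
  by rewrite cmod0 mulr1.
have mz : cmod z != 0 by rewrite cmod_eq0.
rewrite mulrA; case: z z0 mz => a b z0 mz /=.
apply/eqP; rewrite eq_complex/=; apply/andP; split; apply/eqP; field.
all: by rewrite ?mz.
Qed.

Lemma sqr_cmodB_polar (r s : R) z w : cmod z = 1 -> cmod w = 1 ->
  cmod (Complex r 0 * z - Complex s 0 * w) ^+ 2 =
  (r - s) ^+ 2 + r * s * cmod (z - w) ^+ 2.
Proof.
case: z => a b; case: w => c d z1 w1.
have := sqr_cmod a b; have := sqr_cmod c d; rewrite z1 w1 !expr1n => cd ab.
have -> : Complex r 0 * Complex a b - Complex s 0 * Complex c d =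
    Complex (r * a - s * c) (r * b - s * d).
  by apply/eqP; rewrite eq_complex/=; apply/andP; split; apply/eqP; ring.
have -> : Complex a b - Complex c d = Complex (a - c) (b - d) by [].
rewrite !sqr_cmod.
have -> : (r * a - s * c) ^+ 2 + (r * b - s * d) ^+ 2 =
  r ^+ 2 * (a ^+ 2 + b ^+ 2) + s ^+ 2 * (c ^+ 2 + d ^+ 2)
   - 2 * r * s * (a * c + b * d) by ring.
have -> : (a - c) ^+ 2 + (b - d) ^+ 2 = (a ^+ 2 + b ^+ 2) + (c ^+ 2 + d ^+ 2)
   - 2 * (a * c + b * d) by ring.
rewrite -ab -cd; ring.
Qed.

End Modulus.

(** * Inequalities between real powers *)

Section PowerInequalities.
Context {R : realType}.
Implicit Types (a b h p r s t x y : R).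

Lemma young_powR p x y : 1 <= p -> 0 <= x -> 0 <= y ->
  p * (x * y `^ (p - 1)) <= x `^ p + (p - 1) * y `^ p.
Proof.
move=> p1 x0 y0; have [->|pn1] := eqVneq p 1.
  by rewrite subrr powRr0 mul0r addr0 mul1r mulr1 powRr1.
have {pn1}p1' : 1 < p by rewrite lt_neqAle eq_sym pn1.
have p0 : 0 < p by lra.
have pm : 0 < p - 1 by lra.
have := @conjugate_powR R x (y `^ (p - 1)) p (p / (p - 1)) x0 (powR_ge0 _ _) p0.
rewrite divr_gt0// => /(_ isT).
have -> : p^-1 + (p / (p - 1))^-1 = 1 by field; lra.
move=> /(_ erefl); rewrite -powRrM.
have -> : (p - 1) * (p / (p - 1)) = p by field; lra.
rewrite -(ler_pM2l p0); congr (_ <= _).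
by field; apply/andP; split; lra.
Qed.

Lemma bernoulli_powR p a : 1 <= p -> 0 <= a -> 1 + p * a <= (1 + a) `^ p.
Proof.
move=> p1 a0; have := @young_powR p (1 + a) 1 p1.
rewrite !powR1 ler01 => /(_ _ isT) H; have := H ltac:(lra).
lra.
Qed.

(** The derivative [b ((1 + h)^(b-1) + (1 - h)^(b-1) - 2)] of the difference is
    non-negative by the inequality of arithmetic and geometric means. *)
Lemma powR_diff_ge_lt1 b h : 0 < b -> b <= 1 -> 0 <= h -> h < 1 ->
  2 * b * h <= (1 + h) `^ b - (1 - h) `^ b.
Proof.
move=> b0 b1 h0 h1.
pose F (t : R) : R := (1 + t) `^ b - (1 - t) `^ b - 2 * b * t.
have dF (t : R) : -1 < t < 1 ->
    is_derive t 1 F (b * ((1 + t) `^ (b - 1) + (1 - t) `^ (b - 1) - 2)).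
  move=> /andP[t0 t1].
  have d1 : is_derive t 1 (fun t : R => (1 + t) `^ b) (b * (1 + t) `^ (b - 1)).
    have P0 : 0 < 1 + t by lra.
    have D : is_derive t 1 (fun t : R => 1 + t) 1.
      by apply: is_derive_eq; rewrite add0r mul1r.
    have := is_derive1_comp (is_derive1_powR b P0) D.
    by rewrite mulr1.
  have d2 : is_derive t 1 (fun t : R => (1 - t) `^ b) (- (b * (1 - t) `^ (b - 1))).
    have P0 : 0 < 1 - t by lra.
    have D : is_derive t 1 (fun t : R => 1 - t) (- 1).
      by apply: is_derive_eq; rewrite add0r mul1r.
    have := @is_derive1_comp R (fun u : R => u `^ b) (fun t => 1 - t) t _ _
      (is_derive1_powR b P0) D.
    by rewrite mulrN1.
  apply: is_derive_eq.
  rewrite /GRing.scale/=; ring.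
have F0 : F 0 = 0 by rewrite /F; rewrite addr0 subr0 mulr0 subr0 subrr.
suff : F 0 <= F h by rewrite F0 /F subr_ge0.
apply: (@ger0_derive1_ndecr R F 0 h) => //.
- move=> t; rewrite in_itv/= => /andP[t0 th].
  by have [] := dF t ltac:(lra).
- move=> t; rewrite in_itv/= => /andP[t0 th].
  have := dF t ltac:(lra) => D; rewrite derive1E derive_val.
  apply: mulr_ge0; first lra.
  have u0 : 0 <= 1 + t by lra.
  have v0 : 0 <= 1 - t by lra.
  have v00 : 0 < 1 - t by lra.
  (* the two powers have product at least 1 *)
  set u := (1 + t) `^ _; set v := (1 - t) `^ _.
  have uv : 1 <= u * v.
    rewrite /u /v -powRM//.
    have -> : b - 1 = - (1 - b) by lra.
    rewrite powRN invr_ge1; last 2 first.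
    - by rewrite unitfE gt_eqF// powR_gt0//; nra.
    - by rewrite powR_gt0//; nra.
    apply: (@le_trans _ _ (1 `^ (1 - b))); last by rewrite powR1.
    by apply: ge0_ler_powR; rewrite ?nnegrE; nra.
  have u1 : 0 <= u by exact: powR_ge0.
  have v1 : 0 <= v by exact: powR_ge0.
  by have := sqr_ge0 (u - v); nra.
- apply: derivable_within_continuous => t.
  rewrite in_itv/= => /andP[t0 th].
  by have [] := dF t ltac:(lra).
Qed.

Lemma powR_diff_ge b h : 0 < b -> b <= 1 -> 0 <= h -> h <= 1 ->
  2 * b * h <= (1 + h) `^ b - (1 - h) `^ b.
Proof.
move=> b0 b1 h0; rewrite le_eqVlt => /predU1P[->|h1]; last first.
  exact: powR_diff_ge_lt1.
rewrite subrr powR0 ?gt_eqF// subr0 mulr1 leNgt; apply/negP => H.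
set c := (1 + 1 : R) `^ b in H.
have c0 : 0 <= c by exact: powR_ge0.
(* a value of the parameter below 1 for which the strict case fails *)
pose t := (c / (2 * b) + 1) / 2.
have cb : c / (2 * b) < 1 by rewrite ltr_pdivrMr ?mul1r//; lra.
have cb0 : 0 <= c / (2 * b) by rewrite divr_ge0//; lra.
have t0 : 0 <= t by rewrite /t; lra.
have t1 : t < 1 by rewrite /t; lra.
have := powR_diff_ge_lt1 b0 b1 t0 t1.
have : (1 + t) `^ b <= c by apply: ge0_ler_powR; rewrite ?nnegrE; lra.
have := powR_ge0 (1 - t) b.
have -> : 2 * b * t = (c + 2 * b) / 2 by rewrite /t; field; lra.
lra.
Qed.

(** This is the midpoint inequality for the convex derivative of the concave
    function [t^(1/p)] between [s^p] and [r^p]; it holds for all [p >= 1],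
    although the derivative of [t^p] is not convex when [p < 2]. *)
Lemma powR_sub_le p r s : 1 <= p -> 0 <= s -> s <= r ->
  r `^ p - s `^ p <=
  p * (r - s) * ((r `^ p + s `^ p) / 2) `^ ((p - 1) / p).
Proof.
move=> p1 s0 sr; have r0 : 0 <= r by lra.
have p0 : 0 < p by lra.
have [r00|rn0] := eqVneq r 0.
  have -> : s = 0 by apply/eqP; rewrite eq_le s0 -r00 sr.
  by rewrite r00 !subrr mulr0 mul0r.
have {rn0}r0' : 0 < r by rewrite lt_neqAle eq_sym rn0.
set A := r `^ p; set B := s `^ p.
have A0 : 0 < A by exact: powR_gt0.
have B0 : 0 <= B by exact: powR_ge0.
have BA : B <= A by apply: ge0_ler_powR; rewrite ?nnegrE//; lra.
pose m := (A + B) / 2; pose h := (A - B) / (A + B).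
have m0 : 0 < m by rewrite /m; lra.
have h0 : 0 <= h by rewrite divr_ge0//; lra.
have h1 : h <= 1 by rewrite ler_pdivrMr; lra.
have root u : 0 <= u -> u = (u `^ p) `^ p^-1.
  by move=> u0; rewrite -powRrM mulfV ?gt_eqF// powRr1.
have rE : r = m `^ p^-1 * (1 + h) `^ p^-1.
  rewrite -powRM//; try lra.
  have -> : m * (1 + h) = A by rewrite /m /h; field; lra.
  exact: root.
have sE : s = m `^ p^-1 * (1 - h) `^ p^-1.
  rewrite -powRM//; try lra.
  have -> : m * (1 - h) = B by rewrite /m /h; field; lra.
  exact: root.
have ip0 : 0 < p^-1 by rewrite invr_gt0.
have ip1 : p^-1 <= 1 by rewrite invf_le1.
have := powR_diff_ge ip0 ip1 h0 h1.
rewrite -(@ler_pM2l _ (m `^ p^-1)); last exact: powR_gt0.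
rewrite mulrBr -rE -sE => H.
have mm : m `^ p^-1 * m `^ ((p - 1) / p) = m.
  rewrite -powRD; last by rewrite (gt_eqF m0) implybT.
  have -> : p^-1 + (p - 1) / p = 1 by field; lra.
  by rewrite powRr1//; lra.
rewrite -/m; set M := m `^ ((p - 1) / p) in mm *.
have M0 : 0 <= M by exact: powR_ge0.
apply: (@le_trans _ _ (p * (m `^ p^-1 * (2 * p^-1 * h)) * M)).
  rewrite (_ : _ * M = (m `^ p^-1 * M) * (p * p^-1) * (2 * h)); last by ring.
  rewrite mm mulfV ?gt_eqF// mulr1 /h /m.
  by rewrite (_ : (A + B) / 2 * _ = A - B)//; field; lra.
by apply: ler_wpM2r => //; apply: ler_wpM2l => //; lra.
Qed.

End PowerInequalities.

(** * The inequality on a single edge *)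

Section EdgeInequality.
Context {R : realType}.
Implicit Types (a p r s : R) (z w : R[i]).

Definition hardy_const p a : R :=
  2 `^ (1 - p) * (p ^+ 2 + 1) `^ (p / 2) * (1 + a) `^ p.

(** The bound [p ^+ 2 + 1 >= 2] suffices for [p < 2], and [p ^+ 2 + 1 >= 4] for
    [p >= 2]. *)
Lemma hardy_const_gt p a : 1 <= p -> 0 <= a -> (1 + a) `^ p < hardy_const p a.
Proof.
move=> p1 a0; rewrite ltr_pMl; last by rewrite powR_gt0//; lra.
have [p2|p2] := ltP p 2.
- apply: (@lt_le_trans _ _ (2 `^ (1 - p) * 2 `^ (p / 2))).
    rewrite -powRD; last by rewrite pnatr_eq0 implybT.
    have -> : 1 - p + p / 2 = 1 - p / 2 by field.
    rewrite -[ltLHS](powRr0 2) lt_neqAle ler_powR ?andbT; try lra.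
    rewrite powRr0 eq_sym powR_eq1 negb_or negb_or; apply/and3P; split; lra.
  apply: ler_wpM2l; first exact: powR_ge0.
  by apply: ge0_ler_powR; rewrite ?nnegrE; nra.
- apply: (@lt_le_trans _ _ (2 `^ (1 - p) * 2 `^ p)).
    rewrite -powRD; last by rewrite pnatr_eq0 implybT.
    by rewrite subrK powRr1; lra.
  apply: ler_wpM2l; first exact: powR_ge0.
  have -> : 2 `^ p = (2 `^ 2) `^ (p / 2) :> R.
    by rewrite -powRrM; congr (_ `^ _); field.
  rewrite powR_mulrn//.
  by apply: ge0_ler_powR; rewrite ?nnegrE; nra.
Qed.

Lemma hardy_const_gt1 p a : 1 <= p -> 0 <= a -> 1 < hardy_const p a.
Proof.
move=> p1 a0; apply: le_lt_trans (hardy_const_gt p1 a0).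
by have := bernoulli_powR p1 a0; nra.
Qed.

(** Splitting [|r z - s w|^2 = (r - s)^2 + r s |z - w|^2], the increment of the
    moduli and the angular part are summed with the Cauchy-Schwarz inequality
    in the plane; [p] is the weight of the first one by [powR_sub_le]. *)
Lemma coarea_density_le p r s z w : 1 <= p -> 0 <= s -> s <= r ->
  cmod z = 1 -> cmod w = 1 ->
  (r `^ p - s `^ p) + s `^ p * cmod (z - w) <=
  (p ^+ 2 + 1) `^ (2^-1) * cmod (Complex r 0 * z - Complex s 0 * w) *
  ((r `^ p + s `^ p) / 2) `^ ((p - 1) / p).
Proof.
move=> p1 s0 sr z1 w1; have r0 : 0 <= r by lra.
have := sqr_cmodB_polar r s z1 w1.
set d := cmod (z - w); set D := cmod (_ - _) => D2.
have d0 : 0 <= d by exact: cmod_ge0.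
have D0 : 0 <= D by exact: cmod_ge0.
set M := _ `^ ((p - 1) / p); have M0 : 0 <= M by exact: powR_ge0.
have rs : s `^ p <= r `^ p by apply: ge0_ler_powR; rewrite ?nnegrE//; lra.
have sM : s `^ p <= s * M.
  rewrite -(@mulr_powRB1 _ s p)//; last lra.
  apply: ler_wpM2l => //.
  have -> : s `^ (p - 1) = (s `^ p) `^ ((p - 1) / p).
    by rewrite -powRrM; congr (_ `^ _); field; lra.
have := powR_ge0 r p; have := powR_ge0 s p => sp rp.
  apply: ge0_ler_powR; rewrite ?nnegrE; try lra.
  by rewrite divr_ge0//; lra.
apply: (@le_trans _ _ ((p * (r - s) + s * d) * M)).
  rewrite mulrDl lerD//; first exact: powR_sub_le.
  by rewrite mulrAC ler_wpM2r.
apply: ler_wpM2r => //.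
rewrite powR12_sqrt; last by rewrite addr_ge0// sqr_ge0.
have -> : D = Num.sqrt (D ^+ 2) by rewrite sqrtr_sqr ger0_norm.
rewrite -sqrtrM; last by rewrite addr_ge0// sqr_ge0.
rewrite -[leLHS]ger0_norm; last by rewrite addr_ge0 ?mulr_ge0//; lra.
rewrite -sqrtr_sqr ler_sqrt; last by rewrite mulr_ge0 ?addr_ge0 ?sqr_ge0.
rewrite D2.
apply: (@le_trans _ _ ((p ^+ 2 + 1) * ((r - s) ^+ 2 + (s * d) ^+ 2))).
  have := sqr_ge0 (p * (s * d) - (r - s)); nra.
apply: ler_wpM2l; first by rewrite addr_ge0// sqr_ge0.
rewrite lerD2l exprMn ler_wpM2r ?sqr_ge0//; nra.
Qed.

(** Young's inequality, with the weight [1 + a] absorbed in the first factor,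
    separates the energy density from the two vertex terms. *)
Lemma coarea_edge_le p a r s z w : 1 <= p -> 0 <= a -> 0 <= r -> 0 <= s ->
  cmod z = 1 -> cmod w = 1 ->
  p * (1 + a) * (`|r `^ p - s `^ p| + Num.min (r `^ p) (s `^ p) * cmod (z - w))
  <= hardy_const p a * cmod (Complex r 0 * z - Complex s 0 * w) `^ p
     + (p - 1) * (r `^ p + s `^ p).
Proof.
move=> p1 a0; wlog sr : r s z w / s <= r => [H r0 s0 z1 w1|].
  have [sr|/ltW rs] := leP s r; first exact: H.
  rewrite distrC minC (cmod_distC z) (cmod_distC (_ * z)) (addrC (r `^ p)).
  exact: H.
move=> r0 s0 z1 w1.
have p0 : 0 < p by lra.
have rs : s `^ p <= r `^ p by apply: ge0_ler_powR; rewrite ?nnegrE//; lra.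
rewrite (min_r rs) ger0_norm ?subr_ge0//.
have := coarea_density_le p1 s0 sr z1 w1.
set D := cmod (_ * z - _); set A := _ + s `^ p * _.
have D0 : 0 <= D by exact: cmod_ge0.
have q0 : 0 <= p ^+ 2 + 1 by rewrite addr_ge0// sqr_ge0.
have S0 : 0 <= r `^ p + s `^ p by rewrite addr_ge0 ?powR_ge0.
move=> H.
pose x := (1 + a) * (p ^+ 2 + 1) `^ (2^-1) * D * 2 `^ ((1 - p) / p).
pose y := (r `^ p + s `^ p) `^ p^-1.
have x0 : 0 <= x by rewrite !mulr_ge0 ?powR_ge0//; lra.
have := young_powR p1 x0 (powR_ge0 _ _ : 0 <= y).
have -> : y `^ p = r `^ p + s `^ p.
  by rewrite -powRrM mulVf ?gt_eqF// powRr1.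
have -> : x `^ p = hardy_const p a * D `^ p.
  have a1 : 0 <= 1 + a by lra.
  rewrite /x !powRM ?mulr_ge0 ?powR_ge0//.
  rewrite -!powRrM /hardy_const.
  have -> : (1 - p) / p * p = 1 - p by field; lra.
  rewrite (mulrC 2^-1 p); ring.
apply: le_trans; rewrite -mulrA ler_pM2l//.
apply: (@le_trans _ _ ((1 + a) * ((p ^+ 2 + 1) `^ 2^-1 * D *
    ((r `^ p + s `^ p) / 2) `^ ((p - 1) / p)))).
  by apply: ler_wpM2l => //; lra.
rewrite powRM ?invr_ge0// /x /y.
have -> : ((r `^ p + s `^ p) `^ p^-1) `^ (p - 1) =
    (r `^ p + s `^ p) `^ ((p - 1) / p).
  by rewrite -powRrM mulrC.
have -> : (2^-1 : R) `^ ((p - 1) / p) = 2 `^ ((1 - p) / p).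
  rewrite -powR_inv1// -powRrM; congr (_ `^ _); field; lra.
rewrite le_eqVlt; apply/orP; left; apply/eqP; ring.
Qed.

End EdgeInequality.

(** * Sums over vertices and edges *)

Section Sums.
Context {R : realType} {X : choiceType}.
Variable G : magnetic_graph R X.
Implicit Types (u v g : X -> R) (h k : X -> X -> R).

Local Notation b := (edge_weight G).
Local Notation m := (vertex_measure G).

Definition fsupp u := finite_set [set x | u x != 0].

Lemma pairingE (A : set X) g u : finite_set A -> (forall x, ~ A x -> u x = 0) ->
  pairing G g u = \sum_(x <- fset_set A) g x * u x * m x.
Proof.
move=> fA Au; rewrite /pairing (fsbigTE (fset_set A))// => x.
by rewrite in_fset_set// notin_setE => /Au ->; rewrite mulr0 mul0r.
Qed.

Lemma pairing_suppE g u : fsupp u ->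
  pairing G g u = \sum_(x <- fset_set [set x | u x != 0]) g x * u x * m x.
Proof. by move=> fu; apply: pairingE => // x /negP; rewrite negbK => /eqP. Qed.

Lemma pairingDl g g' u : fsupp u ->
  pairing G (fun x => g x + g' x) u = pairing G g u + pairing G g' u.
Proof.
move=> fu; rewrite !(pairing_suppE _ fu) -big_split/=.
by apply: eq_bigr => x _; rewrite !mulrDl.
Qed.

Lemma pairingZl (c : R) g u : fsupp u ->
  pairing G (fun x => c * g x) u = c * pairing G g u.
Proof.
move=> fu; rewrite !(pairing_suppE _ fu) mulr_sumr.
by apply: eq_bigr => x _; rewrite !mulrA.
Qed.

Lemma eq_pairing g g' u : g =1 g' -> pairing G g u = pairing G g' u.
Proof. by move=> gg'; apply: eq_fsbigr => x _; rewrite gg'. Qed.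

Lemma nsuppU u v (A := [set x | u x != 0] `|` [set x | v x != 0]) :
  (forall x, ~ A x -> u x = 0) /\ (forall x, ~ A x -> v x = 0).
Proof. by split=> x /not_orP[/negP + /negP]; rewrite !negbK => /eqP + /eqP. Qed.

Lemma pairingDr g u v : fsupp u -> fsupp v ->
  pairing G g (fun x => u x + v x) = pairing G g u + pairing G g v.
Proof.
move=> fu fv.
have fA : finite_set ([set x | u x != 0] `|` [set x | v x != 0]).
  by rewrite finite_setU.
have [Au Av] := nsuppU u v.
rewrite (pairingE g fA Au) (pairingE g fA Av) (pairingE g fA) => [|x Ax].
  2: by rewrite Au// Av// addr0.
by rewrite -big_split/=; apply: eq_bigr => x _; rewrite mulrDr mulrDl.
Qed.

Lemma fsuppZ (c : R) u : fsupp u -> fsupp (fun x => c * u x).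
Proof.
apply: sub_finite_set => x /=; apply: contra_neq => ->; exact: mulr0.
Qed.

Lemma pairingZr (c : R) g u : fsupp u ->
  pairing G g (fun x => c * u x) = c * pairing G g u.
Proof.
move=> fu; rewrite (pairingE _ fu) ?(pairing_suppE _ fu) => [|x].
  by rewrite mulr_sumr; apply: eq_bigr => x _; ring.
by move=> /negP; rewrite negbK => /eqP ->; rewrite mulr0.
Qed.

Lemma pairing_ge0 g u : (forall x, 0 <= g x) -> (forall x, 0 <= u x) ->
  0 <= pairing G g u.
Proof.
move=> g0 u0; apply: fsumr_ge0 => x _.
by rewrite !mulr_ge0// ltW// vertex_measure_gt0.
Qed.

Lemma pairing_esum g u : fsupp u -> (forall x, 0 <= g x) -> (forall x, 0 <= u x) ->
  (pairing G g u)%:E = (\esum_(x in [set: X]) (g x * u x * m x)%:E)%E.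
Proof.
move=> fu g0 u0; set A := [set x | u x != 0].
rewrite (pairing_suppE _ fu) -/A -fsbig_finite//.
rewrite -fsumEFin// -esum_fset//; last first.
  by move=> x _; rewrite lee_fin !mulr_ge0// ltW// vertex_measure_gt0.
rewrite esum_mkcond; apply: eq_esum => x _; case: ifPn => //.
rewrite notin_setE /A/= => /negP; rewrite negbK => /eqP ->.
by rewrite mulr0 mul0r.
Qed.

Lemma EFin_total_weight x :
  (total_weight G x)%:E = (\esum_(y in [set: X]) (b x y)%:E)%E.
Proof.
rewrite fineK// ge0_fin_numE ?edge_weight_summable// esum_ge0// => y _.
by rewrite lee_fin edge_weight_ge0.
Qed.

Lemma total_weight_ge0 x : 0 <= total_weight G x.
Proof.
rewrite fine_ge0// esum_ge0// => y _.
by rewrite lee_fin edge_weight_ge0.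
Qed.

Definition edge_Deg (x : X) : R := (m x)^-1 * total_weight G x.

Lemma edge_Deg_ge0 x : 0 <= edge_Deg x.
Proof. by rewrite mulr_ge0 ?total_weight_ge0// invr_ge0 ltW// vertex_measure_gt0. Qed.

Definition edge_sum h : \bar R :=
  ((2^-1)%:E * \esum_(z in [set: X * X]) (b z.1 z.2 * h z.1 z.2)%:E)%E.

Lemma edge_sum_ge0 h : (forall x y, 0 <= h x y) -> (0 <= edge_sum h)%E.
Proof.
move=> h0; rewrite mule_ge0// ?lee_fin// esum_ge0// => z _.
by rewrite lee_fin mulr_ge0// edge_weight_ge0.
Qed.

Lemma le_edge_sum h k : (forall x y, h x y <= k x y) ->
  (edge_sum h <= edge_sum k)%E.
Proof.
move=> hk; apply: lee_wpmul2l; first by rewrite lee_fin.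
by apply: le_esum => z _; rewrite lee_fin ler_wpM2l// edge_weight_ge0.
Qed.

Lemma eq_edge_sum h k : (forall x y, h x y = k x y) -> edge_sum h = edge_sum k.
Proof. by move=> hk; congr (_ * _)%E; apply: eq_esum => z _; rewrite hk. Qed.

Lemma edge_sumD h k : (forall x y, 0 <= h x y) -> (forall x y, 0 <= k x y) ->
  edge_sum (fun x y => h x y + k x y) = (edge_sum h + edge_sum k)%E.
Proof.
move=> h0 k0; have b0 := edge_weight_ge0 G.
rewrite /edge_sum -ge0_muleDr; last 2 first.
- by rewrite esum_ge0// => z _; rewrite lee_fin mulr_ge0.
- by rewrite esum_ge0// => z _; rewrite lee_fin mulr_ge0.
rewrite -esumD => [|z _|z _]; last 2 first.
- by rewrite lee_fin mulr_ge0.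
- by rewrite lee_fin mulr_ge0.
by congr (_ * _)%E; apply: eq_esum => z _; rewrite -EFinD mulrDr.
Qed.

Lemma esumZl (T : choiceType) (A : set T) (c : R) (f : T -> \bar R) : 0 <= c ->
  (forall x, (0 <= f x)%E) ->
  (\esum_(x in A) (c%:E * f x) = c%:E * \esum_(x in A) f x)%E.
Proof.
rewrite le_eqVlt => /predU1P[<- f0|c0 f0].
  by rewrite mul0e esum1// => x _; rewrite mul0e.
have H (d : R) (f' : T -> \bar R) : 0 < d -> (forall x, (0 <= f' x)%E) ->
    (\esum_(x in A) (d%:E * f' x) <= d%:E * \esum_(x in A) f' x)%E.
  move=> d0 f'0; apply: ge_ereal_sup => _ [B BA <-].
  rewrite -ge0_mule_fsumr//; apply: lee_wpmul2l; first by rewrite lee_fin ltW.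
  by apply: ereal_sup_ubound; exists B.
apply/eqP; rewrite eq_le H//=.
rewrite -[leRHS]mul1e -(divff (lt0r_neq0 c0)) EFinM -muleA.
apply: lee_wpmul2l; first by rewrite lee_fin ltW.
apply: le_trans; last (apply: H => [|x]; first by rewrite invr_gt0).
  apply: le_esum => x _; rewrite muleA -EFinM mulVf ?gt_eqF// mul1e//.
by rewrite mule_ge0// lee_fin ltW.
Qed.

Lemma edge_sumZ (c : R) h : 0 <= c -> (forall x y, 0 <= h x y) ->
  edge_sum (fun x y => c * h x y) = (c%:E * edge_sum h)%E.
Proof.
move=> c0 h0; rewrite /edge_sum muleCA -[in RHS]esumZl => [||z]//; last first.
  by rewrite lee_fin mulr_ge0// edge_weight_ge0.
by congr (_ * _)%E; apply: eq_esum => z _; rewrite -EFinM mulrCA.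
Qed.

Lemma edge_sum_fst u : fsupp u -> (forall x, 0 <= u x) ->
  (\esum_(z in [set: X * X]) (b z.1 z.2 * u z.1)%:E = (pairing G edge_Deg u)%:E)%E.
Proof.
move=> fu u0; rewrite (pairing_esum fu edge_Deg_ge0 u0).
rewrite (_ : [set: X * X] = [set: X] `*`` (fun=> [set: X])); last first.
  by apply/seteqP; split.
rewrite -(@esum_esum _ _ _ _ _ (fun x y => (b x y * u x)%:E)); last first.
  by move=> x y _ _; rewrite lee_fin mulr_ge0// edge_weight_ge0.
apply: eq_esum => x _.
under eq_esum do rewrite mulrC EFinM.
rewrite esumZl// => [|y]; last by rewrite lee_fin edge_weight_ge0.
rewrite -EFin_total_weight -EFinM; congr (_%:E).
by rewrite /edge_Deg; field; rewrite gt_eqF// vertex_measure_gt0.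
Qed.

(** The symmetry of the edge weights exchanges the two endpoints. *)
Lemma edge_sum_vertex u : fsupp u -> (forall x, 0 <= u x) ->
  edge_sum (fun x y => u x + u y) = (pairing G edge_Deg u)%:E.
Proof.
move=> fu u0; rewrite edge_sumD//.
have E1 : edge_sum (fun x _ => u x) = (2^-1 * pairing G edge_Deg u)%:E.
  by rewrite EFinM -edge_sum_fst.
have -> : edge_sum (fun _ y => u y) = edge_sum (fun x _ => u x).
  congr (_ * _)%E.
  rewrite (@reindex_esum _ _ _ setT setT (fun z : X * X => (z.2, z.1)))/=; last first.
    split=> // [[x y] [x' y'] _ _ [-> ->]//|[x y] _].
    by exists (y, x).
  by apply: eq_esum => z _; rewrite edge_weight_sym.
by rewrite E1 -EFinD; congr (_%:E); field.
Qed.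

End Sums.

(** * The energy and the weighted degree *)

Section Energy.
Context {R : realType} {X : choiceType}.
Variable G : magnetic_graph R X.
Implicit Types (u v g : X -> R) (f : X -> R[i]) (p a k : R).

Local Notation b := (edge_weight G).
Local Notation m := (vertex_measure G).
Local Notation theta := (magnetic_potential G).
Local Notation q := (potential G).

Definition qpos : X -> R := (q^\+)%R.
Definition qneg : X -> R := (q^\-)%R.

Lemma qpos_ge0 x : 0 <= qpos x. Proof. exact: funrpos_ge0. Qed.
Lemma qneg_ge0 x : 0 <= qneg x. Proof. exact: funrneg_ge0. Qed.
Lemma potentialE x : q x = qpos x - qneg x.
Proof. by rewrite /qpos /qneg -[LHS]/(q x) -{1}(funrposBneg q). Qed.

Lemma modpow_ge0 p f x : 0 <= modpow p f x.
Proof. exact: powR_ge0. Qed.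

Lemma fsupp_modpow p f : p != 0 -> Cc f -> fsupp (modpow p f).
Proof.
move=> p0; apply: sub_finite_set => x /=; apply: contra_neq => fx.
by rewrite /modpow fx cmod0 powR0.
Qed.

Definition Degpos (x : X) : R := edge_Deg G x + qpos x.

Lemma Degpos_ge0 x : 0 <= Degpos x.
Proof. by rewrite addr_ge0 ?edge_Deg_ge0 ?qpos_ge0. Qed.

Definition grad p f (x y : X) : R := cmod (f x - expi (theta x y) * f y) `^ p.

Definition grad_energy p f : R := fine (edge_sum G (grad p f)).

(** For [f] of finite support the energy is [pos_energy - neg_norm], and the
    pairing of the weighted degree with [|f|^p] is [deg_norm - neg_norm]; all
    three quantities are non-negative. *)
Definition pos_energy p f : R := grad_energy p f + pairing G qpos (modpow p f).
Definition deg_norm p f : R := pairing G Degpos (modpow p f).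
Definition neg_norm p f : R := pairing G qneg (modpow p f).
Definition mass_norm p f : R := pairing G (fun=> 1) (modpow p f).

Lemma neg_norm_ge0 p f : 0 <= neg_norm p f.
Proof. by apply: pairing_ge0 => x; [exact: qneg_ge0|exact: modpow_ge0]. Qed.
Lemma mass_norm_ge0 p f : 0 <= mass_norm p f.
Proof. by apply: pairing_ge0 => x; [exact: ler01|exact: modpow_ge0]. Qed.

Lemma grad_ge0 p f x y : 0 <= grad p f x y.
Proof. exact: powR_ge0. Qed.

Lemma grad_energy_ge0 p f : 0 <= grad_energy p f.
Proof. by rewrite fine_ge0// edge_sum_ge0// => x y; exact: grad_ge0. Qed.

Lemma pos_energy_ge0 p f : 0 <= pos_energy p f.
Proof.
rewrite addr_ge0 ?grad_energy_ge0// pairing_ge0// => x.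
  exact: qpos_ge0.
exact: modpow_ge0.
Qed.

Lemma powRD_le p r s t : 0 <= p -> 0 <= r -> 0 <= s -> 0 <= t -> t <= r + s ->
  t `^ p <= 2 `^ p * (r `^ p + s `^ p).
Proof.
move=> p0; wlog sr : r s / s <= r => [H r0 s0|r0 s0 t0 trs].
  have [sr|/ltW rs] := leP s r; first exact: H.
  by move=> t0; rewrite addrC (addrC (r `^ p)); exact: H.
apply: (@le_trans _ _ ((2 * r) `^ p)).
  by apply: ge0_ler_powR; rewrite ?nnegrE//; lra.
by rewrite powRM// ler_wpM2l ?powR_ge0// lerDl powR_ge0.
Qed.

Lemma grad_le p f x y : 0 <= p ->
  grad p f x y <= 2 `^ p * (modpow p f x + modpow p f y).
Proof.
move=> p0; apply: powRD_le; rewrite ?cmod_ge0//.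
have := le_cmodD (f x) (- (expi (theta x y) * f y)).
by rewrite cmodN cmodM cmod_expi mul1r.
Qed.

Lemma grad_energyE p f : 0 < p -> Cc f ->
  edge_sum G (grad p f) = (grad_energy p f)%:E.
Proof.
move=> p0 fc; rewrite fineK// ge0_fin_numE ?edge_sum_ge0//; last exact: grad_ge0.
apply: le_lt_trans (le_edge_sum G (fun x y => grad_le f x y (ltW p0))) _.
rewrite edge_sumZ ?powR_ge0// => [|x y]; last by rewrite addr_ge0// modpow_ge0.
rewrite edge_sum_vertex -?EFinM ?ltry// => [|x].
  by apply: fsupp_modpow => //; rewrite gt_eqF.
exact: modpow_ge0.
Qed.

Lemma grad_energy_le p f : 0 < p -> Cc f ->
  grad_energy p f <= 2 `^ p * pairing G (edge_Deg G) (modpow p f).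
Proof.
move=> p0 fc; rewrite -lee_fin -grad_energyE//.
apply: le_trans (le_edge_sum G (fun x y => grad_le f x y (ltW p0))) _.
rewrite edge_sumZ ?powR_ge0// => [|x y]; last by rewrite addr_ge0// modpow_ge0.
rewrite edge_sum_vertex -?EFinM// => [|x].
  by apply: fsupp_modpow => //; rewrite gt_eqF.
exact: modpow_ge0.
Qed.

Lemma energyE p f : 0 < p -> Cc f ->
  energy G p f = (pos_energy p f - neg_norm p f)%:E.
Proof.
move=> p0 fc; have fu : fsupp (modpow p f) by apply: fsupp_modpow => //; rewrite gt_eqF.
rewrite -[LHS]/(edge_sum G (grad p f) + _)%E grad_energyE// -EFinD; congr (_%:E).
rewrite (@eq_pairing _ _ _ q (fun x => qpos x + - 1 * qneg x)) => [|x]; last first.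
  by rewrite mulN1r -potentialE.
by rewrite pairingDl// pairingZl// mulN1r addrA.
Qed.

Lemma energy_posE p f : 0 < p -> Cc f ->
  energy (with_potential G (q^\+)%R) p f = (pos_energy p f)%:E.
Proof.
by move=> p0 fc; rewrite -[LHS]/(edge_sum G (grad p f) + _)%E grad_energyE.
Qed.

Lemma deg_normE p f : 0 < p -> Cc f -> deg_norm p f =
  pairing G (edge_Deg G) (modpow p f) + pairing G qpos (modpow p f).
Proof.
by move=> p0 fc; rewrite -pairingDl//; apply: fsupp_modpow; rewrite ?gt_eqF.
Qed.

Lemma pairing_DegE p f : 0 < p -> Cc f ->
  pairing G (Deg G) (modpow p f) = deg_norm p f - neg_norm p f.
Proof.
move=> p0 fc; have fu : fsupp (modpow p f) by apply: fsupp_modpow => //; rewrite gt_eqF.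
rewrite (@eq_pairing _ _ _ (Deg G) (fun x => Degpos x + - 1 * qneg x)) => [|x]; last first.
  by rewrite mulN1r -addrA -potentialE.
by rewrite pairingDl// pairingZl// mulN1r.
Qed.

Lemma lpnormE p f : 0 < p -> Cc f -> (lpnorm G p f `^ p)%E = (mass_norm p f)%:E.
Proof.
move=> p0 fc; rewrite /lpnorm -poweRrM mulVf ?gt_eqF// poweRe1; last first.
  apply: esum_ge0 => x _; rewrite lee_fin mulr_ge0 ?modpow_ge0//.
  by rewrite ltW// vertex_measure_gt0.
rewrite /mass_norm pairing_esum//.
- by apply: eq_esum => x _; rewrite mul1r.
- by apply: fsupp_modpow => //; rewrite gt_eqF.
- exact: modpow_ge0.
Qed.

Lemma form_smallE p a : 0 < p -> form_small G p a <->
  exists2 C : R, 0 <= C & forall f, Cc f ->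
    neg_norm p f <= a * pos_energy p f + C * mass_norm p f.
Proof.
move=> p0; split=> -[C C0 H]; exists C => // f fc; have := H f fc;
  by rewrite lpnormE// energy_posE// -!EFinM -EFinD lee_fin.
Qed.

Lemma Deg_boundE p a k : 0 < p -> Deg_bound G p a k <->
  forall f, Cc f -> (1 - a) * (deg_norm p f - neg_norm p f) - k * mass_norm p f
    <= pos_energy p f - neg_norm p f.
Proof.
move=> p0; split=> H f fc; have := H f fc;
  by rewrite lpnormE// energyE// pairing_DegE// -EFinM -EFinB lee_fin.
Qed.

(** An upper bound of the weighted degree form by the energy is a lower bound of
    the full energy: [l := (1 - alpha) / (D - alpha)] is the number for which
    [l D + (1 - l) alpha = 1], so that [l] times the hypothesis and [1 - l] times
    the smallness of [q_-] add up to the energy of [q_+]. *)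
Lemma Deg_bound_of_deg_norm_le p a D k : 0 < p -> 0 < a -> a < 1 -> 1 < D -> 0 <= k ->
  form_small G p a ->
  (forall f, Cc f -> deg_norm p f <= D * pos_energy p f + k * mass_norm p f) ->
  exists k' : R, [/\ 0 <= k', Deg_bound G p (1 - (1 - a) / (D - a)) k' &
    k = 0 -> (forall x, 0 <= q x) -> k' = 0].
Proof.
move=> p0 a0 a1 D1 k0 /(form_smallE _ p0)[C C0 HC] HD.
pose l := (1 - a) / (D - a).
have l0 : 0 <= l by rewrite divr_ge0; lra.
have l1 : l <= 1 by rewrite ler_pdivrMr; lra.
have lE : l * D + (1 - l) * a = 1 by rewrite /l; field; lra.
have [C' [C'0 HC' C'q]] : exists C' : R, [/\ 0 <= C',
    (forall f, Cc f -> neg_norm p f <= a * pos_energy p f + C' * mass_norm p f) &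
    (forall x, 0 <= q x) -> C' = 0].
  have [q0|q0] := pselect (forall x, 0 <= q x); last by exists C; split.
  exists 0; split=> // f fc; rewrite mul0r addr0.
  rewrite /neg_norm (@eq_pairing _ _ _ _ (fun=> 0)) => [|x]; last first.
    by rewrite /qneg (@ge0_funrnegE _ _ setT)// in_setT.
  rewrite /pairing fsbig1 ?mulr_ge0 ?pos_energy_ge0 ?ltW// => x _.
  by rewrite !mul0r.
exists (l * k + (1 - l) * C'); split.
- by rewrite addr_ge0// mulr_ge0//; lra.
- apply/Deg_boundE => // f fc; rewrite (_ : 1 - (1 - _) = l); last by rewrite /l; ring.
  have := HD f fc; have := HC' f fc; have := mass_norm_ge0 p f.
  move: (deg_norm _ _) (neg_norm _ _) (mass_norm _ _) (pos_energy _ _) => S M N P.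
  move=> N0 HM HS.
  have A1 : l * S <= l * (D * P + k * N) by exact: ler_wpM2l.
  have A2 : (1 - l) * M <= (1 - l) * (a * P + C' * N).
    by apply: ler_wpM2l => //; lra.
  have : (l * D + (1 - l) * a) * P = P by rewrite lE mul1r.
  lra.
- by move=> -> /C'q ->; rewrite !mulr0 addr0.
Qed.

(** The negative part enters both sides, on the left with the smaller factor
    [1 - a], so that it can be dropped. *)
Lemma deg_norm_le_of_Deg_bound p a k : 0 < p -> 0 < a -> a < 1 -> 0 <= k ->
  Deg_bound G p a k -> exists2 K : R, 0 <= K & forall f, Cc f ->
    deg_norm p f <= K * (pos_energy p f + mass_norm p f).
Proof.
move=> p0 a0 a1 k0 /(Deg_boundE _ _ p0) H.
exists ((1 + k) / (1 - a)); first by rewrite divr_ge0//; lra.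
move=> f /H; rewrite mulrAC ler_pdivlMr; last lra.
have := pos_energy_ge0 p f; have := mass_norm_ge0 p f; have := neg_norm_ge0 p f.
move: (deg_norm _ _) (neg_norm _ _) (mass_norm _ _) (pos_energy _ _) => S M N P.
nra.
Qed.

End Energy.

(** * Sparseness in terms of real numbers *)

Section Sparseness.
Context {R : realType} {X : choiceType}.
Variable G : magnetic_graph R X.
Implicit Types (u v g : X -> R) (f tau : X -> R[i]) (p a k : R) (W : set X).

Local Notation b := (edge_weight G).
Local Notation m := (vertex_measure G).
Local Notation theta := (magnetic_potential G).
Local Notation q := (potential G).

Lemma fsupp_indic W : finite_set W -> fsupp (\1_W : X -> R).
Proof.
apply: sub_finite_set => x /=; rewrite indicE.
by case: (boolP (x \in W)) => [/set_mem//|_]; rewrite eqxx.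
Qed.

Lemma indic_ge0 (T : Type) (A : set T) x : 0 <= \1_A x :> R.
Proof. by rewrite indicE ler0n. Qed.

Lemma mass_indic g W : finite_set W -> (forall x, 0 <= g x) ->
  mass (fun x => g x * m x) W = (pairing G g \1_W)%:E.
Proof.
move=> fW g0; rewrite (pairing_esum _ (fsupp_indic fW))//.
rewrite /mass esum_mkcond; apply: eq_esum => x _; rewrite indicE.
by case: ifPn => _; rewrite ?mulr1// mulr0 mul0r.
Qed.

Lemma edge_sum_indic (A : set (X * X)) :
  edge_sum G (fun x y => \1_A (x, y)) =
  ((2^-1)%:E * mass (fun z => b z.1 z.2) A)%E.
Proof.
congr (_ * _)%E; rewrite /mass [in RHS]esum_mkcond; apply: eq_esum => -[x y] _ /=.
by rewrite indicE; case: ifPn => _; rewrite ?mulr1// mulr0.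
Qed.

Definition inner_weight W : R := fine (mass (fun z => b z.1 z.2) (W `*` W)).
Definition boundary_weight W : R :=
  fine ((2^-1)%:E * mass (fun z => b z.1 z.2) (boundary W))%E.

Lemma in_setX W x y : ((x, y) \in W `*` W) = (x \in W) && (y \in W).
Proof.
by apply/idP/andP => [/set_mem[/= ? ?]|[/set_mem ? /set_mem ?]]; [split|]; exact/mem_set.
Qed.

Lemma in_boundary W x y : ((x, y) \in boundary W) = (x \in W) (+) (y \in W).
Proof.
apply/idP/idP => [/set_mem[[/= xW yW]|[/= xW yW]]|].
- by rewrite mem_set// memNset.
- by rewrite [y \in W]mem_set// memNset.
have [/set_mem xW|] := boolP (x \in W); have [/set_mem yW|] := boolP (y \in W) => //.
- by rewrite notin_setE => yW _; apply/mem_set; left.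
- by rewrite notin_setE => xW _; apply/mem_set; right.
Qed.

Lemma indic_setXE W x y : \1_(W `*` W) (x, y) = \1_W x * \1_W y :> R.
Proof. by rewrite !indicE in_setX -mulnb natrM. Qed.

Lemma indic_boundaryE W x y : \1_(boundary W) (x, y) = `|\1_W x - \1_W y| :> R.
Proof.
rewrite !indicE in_boundary; case: (x \in W); case: (y \in W) => /=;
  by rewrite ?subrr ?subr0 ?sub0r ?normrN ?normr0 ?normr1.
Qed.

(** Every edge with an endpoint in [W] has both endpoints in [W] or crosses the
    boundary, so the summability of the weights at each vertex makes both parts
    finite. *)
Lemma weights_fin W : finite_set W ->
  [/\ mass (fun z => b z.1 z.2) (W `*` W) = (inner_weight W)%:E,
      ((2^-1)%:E * mass (fun z => b z.1 z.2) (boundary W))%E = (boundary_weight W)%:E &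
      pairing G (edge_Deg G) \1_W = inner_weight W + boundary_weight W].
Proof.
move=> fW; have := edge_sum_vertex G (fsupp_indic fW) (indic_ge0 W).
rewrite (@eq_edge_sum _ _ _ _
  (fun x y => 2 * \1_(W `*` W) (x, y) + \1_(boundary W) (x, y))) => [|x y]; last first.
  rewrite indic_setXE indic_boundaryE !indicE.
  case: (x \in W); case: (y \in W) => /=;
  by rewrite ?subrr ?subr0 ?sub0r ?normrN ?normr0 ?normr1; ring.
rewrite edge_sumD => [|x y|x y]; rewrite ?mulr_ge0 ?indic_ge0//.
rewrite edge_sumZ => [|//|x y]; last exact: indic_ge0.
rewrite !edge_sum_indic muleA -EFinM mulfV ?pnatr_eq0// mul1e => E.
have m0 A : (0 <= mass (fun z => b z.1 z.2) A)%E.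
  by apply: esum_ge0 => z _; rewrite lee_fin edge_weight_ge0.
have h0 A : (0 <= (2^-1)%:E * mass (fun z => b z.1 z.2) A)%E.
  by rewrite mule_ge0// lee_fin.
have f1 : mass (fun z => b z.1 z.2) (W `*` W) \is a fin_num.
  rewrite ge0_fin_numE//; apply: le_lt_trans (ltry (pairing G (edge_Deg G) \1_W)).
  by rewrite -E leeDl.
have f2 : ((2^-1)%:E * mass (fun z => b z.1 z.2) (boundary W))%E \is a fin_num.
  rewrite ge0_fin_numE//; apply: le_lt_trans (ltry (pairing G (edge_Deg G) \1_W)).
  by rewrite -E leeDr.
rewrite /inner_weight /boundary_weight !fineK//; split=> //.
by apply: EFin_inj; rewrite EFinD !fineK.
Qed.

Definition twist tau x y : R := cmod (tau x - expi (theta x y) * tau y).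

Definition frustration p tau W : R :=
  2^-1 * \sum_(x \in W) \sum_(y \in W) b x y * twist tau x y `^ p.

Lemma frustration_ge0 p tau W : 0 <= frustration p tau W.
Proof.
rewrite mulr_ge0//; apply: fsumr_ge0 => x _; apply: fsumr_ge0 => y _.
by rewrite mulr_ge0 ?powR_ge0 ?edge_weight_ge0.
Qed.

Lemma frustration_index_ge0 p W : 0 <= frustration_index G p W.
Proof.
apply: lb_le_inf; last by move=> _ [tau _ <-]; exact: frustration_ge0.
by exists (frustration p (fun=> 1) W); exists (fun=> 1) => // x _; exact: cmod1.
Qed.

Lemma frustration_index_le p tau W : (forall x, W x -> cmod (tau x) = 1) ->
  frustration_index G p W <= frustration p tau W.
Proof.
move=> t1; apply: ge_inf; last by exists tau.
by exists 0 => _ [t _ <-]; exact: frustration_ge0.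
Qed.

Lemma le_frustration_index p W c :
  (forall tau, (forall x, W x -> cmod (tau x) = 1) -> c <= frustration p tau W) ->
  c <= frustration_index G p W.
Proof.
move=> H; apply: lb_le_inf; last by move=> _ [tau t1 <-]; exact: H.
by exists (frustration p (fun=> 1) W); exists (fun=> 1) => // x _; exact: cmod1.
Qed.

Lemma magnetic_sparseE p a k : magnetic_sparse G p a k <-> forall W, finite_set W ->
  inner_weight W <= (1 + a) * frustration_index G p W +
    a * (boundary_weight W + pairing G (qpos G) \1_W) + k * pairing G (fun=> 1) \1_W.
Proof.
have H W : finite_set W -> mass m W = (pairing G (fun=> 1) \1_W)%:E.
  move=> fW; rewrite -mass_indic//; apply: eq_esum => x _; rewrite mul1r//.
split=> S W fW; have := S W fW; have [E1 E2 _] := weights_fin fW;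
  by rewrite E1 E2 mass_indic ?H//; try exact: qpos_ge0;
  rewrite -!EFinD -!EFinM -!EFinD lee_fin.
Qed.

(** Both the coarea density of an indicator and the gradient of a unimodular
    function cut off outside [W] have this form. *)
Lemma edge_sum_cut W (c : X -> X -> R) : finite_set W -> (forall x y, 0 <= c x y) ->
  edge_sum G (fun x y => `|\1_W x - \1_W y| + Num.min (\1_W x) (\1_W y) * c x y) =
  (boundary_weight W + 2^-1 * \sum_(x \in W) \sum_(y \in W) b x y * c x y)%:E.
Proof.
move=> fW c0; have [_ E2 _] := weights_fin fW.
have min0 x y : 0 <= Num.min (\1_W x) (\1_W y) :> R by rewrite le_min !indic_ge0.
rewrite edge_sumD => [|x y|x y]; rewrite ?mulr_ge0//.
rewrite EFinD -E2 -edge_sum_indic; congr (_ + _)%E.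
  by apply: eq_edge_sum => x y; rewrite indic_boundaryE.
rewrite EFinM; congr (_ * _)%E.
rewrite pair_fsbig//= -fsumEFin; last exact: finite_setX.
rewrite -esum_fset; last 2 first.
- exact: finite_setX.
- by move=> z _; rewrite lee_fin mulr_ge0// edge_weight_ge0.
rewrite [in RHS]esum_mkcond; apply: eq_esum => -[x y] _ /=.
rewrite in_setX !indicE; case: (x \in W); case: (y \in W) => /=;
  by rewrite ?minxx ?mul1r ?mul0r ?mulr0// ?(min_l ler01) ?(min_r ler01) ?mul0r ?mulr0.
Qed.

End Sparseness.

(** * From sparseness to a lower bound of the energy *)

Section Coarea.
Context {R : realType} {X : choiceType}.
Variable G : magnetic_graph R X.
Implicit Types (u v g : X -> R) (f tau : X -> R[i]) (p a k : R) (W : set X).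

Local Notation b := (edge_weight G).
Local Notation m := (vertex_measure G).
Local Notation theta := (magnetic_potential G).
Local Notation q := (potential G).

(** The integral over [t > 0] of the jumps and twists of the edge [(x, y)] seen by
    the superlevel sets [u > t]. *)
Definition coarea_density tau u x y : R :=
  `|u x - u y| + Num.min (u x) (u y) * twist G tau x y.

Definition coarea_energy tau u : R := fine (edge_sum G (coarea_density tau u)).

Lemma coarea_density_ge0 tau u x y : (forall x, 0 <= u x) ->
  0 <= coarea_density tau u x y.
Proof.
by move=> u0; rewrite addr_ge0// mulr_ge0 ?cmod_ge0// le_min !u0.
Qed.

Lemma twist_le2 tau x y : cmod (tau x) = 1 -> cmod (tau y) = 1 -> twist G tau x y <= 2.
Proof.
move=> tx ty; have := le_cmodD (tau x) (- (expi (theta x y) * tau y)).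
by rewrite cmodN cmodM cmod_expi tx ty mul1r.
Qed.

Lemma coarea_energyE tau u : fsupp u -> (forall x, 0 <= u x) ->
  (forall x, cmod (tau x) = 1) ->
  edge_sum G (coarea_density tau u) = (coarea_energy tau u)%:E.
Proof.
move=> fu u0 t1; rewrite fineK// ge0_fin_numE ?edge_sum_ge0//; last first.
  by move=> x y; exact: coarea_density_ge0.
apply: (@le_lt_trans _ _ (edge_sum G (fun x y => 3 * (u x + u y)))).
  apply: le_edge_sum => x y; rewrite /coarea_density.
  have := twist_le2 (t1 x) (t1 y); have := cmod_ge0 (tau x - expi (theta x y) * tau y).
  rewrite -/(twist G tau x y) => t0 t2.
  have ux := u0 x; have uy := u0 y.
  have : Num.min (u x) (u y) * twist G tau x y <= (u x + u y) * 2.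
    apply: ler_pM => //; first by rewrite le_min ux uy.
    by rewrite ge_min lerDl uy.
  have : `|u x - u y| <= u x + u y.
    by rewrite (le_trans (ler_normB _ _))// !ger0_norm.
  lra.
rewrite edge_sumZ// => [|x y]; last by rewrite addr_ge0.
by rewrite edge_sum_vertex// -EFinM ltry.
Qed.

Lemma coarea_energy_indic tau W : finite_set W ->
  coarea_energy tau \1_W = boundary_weight G W + frustration G 1 tau W.
Proof.
move=> fW; rewrite /coarea_energy edge_sum_cut// => [|x y]; last exact: cmod_ge0.
congr (_ + _ * _); apply: eq_fsbigr => x _; apply: eq_fsbigr => y _.
by rewrite powRr1// cmod_ge0.
Qed.

Lemma seq_argmin (s : seq X) u : s != [::] ->
  exists2 x, x \in s & forall y, y \in s -> u x <= u y.
Proof.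
elim: s => // x [|y s] IH _; first by exists x; rewrite ?inE// => z; rewrite inE => /eqP->.
have [//|z zs zP] := IH.
have [xz|/ltW zx] := leP (u x) (u z).
- exists x; first by rewrite inE eqxx.
  by move=> w; rewrite inE => /predU1P[->//|/zP]; exact: le_trans.
- exists z; first by rewrite inE zs orbT.
  by move=> w; rewrite inE => /predU1P[->//|/zP].
Qed.

Lemma coarea_density_level tau u t x y (W := [set x | u x != 0]) : 0 <= t ->
  (forall x, W x -> t <= u x) ->
  coarea_density tau u x y = t * coarea_density tau \1_W x y +
    coarea_density tau (fun x => u x - t * \1_W x) x y.
Proof.
move=> t0 tW; rewrite /coarea_density; set c := twist G tau x y.
have H z : (u z = 0 /\ \1_W z = 0 :> R) \/ (t <= u z /\ \1_W z = 1 :> R).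
  rewrite indicE; case: (boolP (z \in W)) => zW.
    by right; split=> //; apply: tW; exact: set_mem.
  left; split=> //.
  by move: zW; rewrite notin_setE /W/= => /negP; rewrite negbK => /eqP.
have [[-> ->]|[ux ->]] := H x; have [[-> ->]|[uy ->]] := H y.
- by rewrite !(mulr0, subrr, normr0, minxx, mul0r, addr0).
- rewrite !mulr0 !mulr1 !subr0 !sub0r !normrN !(min_l ler01) min_l; last lra.
  rewrite min_l; last lra.
  by rewrite !ger0_norm; try lra.
- rewrite !mulr0 !mulr1 !subr0 !(min_r ler01) min_r; last lra.
  rewrite min_r; last lra.
  by rewrite !ger0_norm; try lra.
- rewrite !mulr1 subrr normr0 minxx.
  have -> : u x - t - (u y - t) = u x - u y by ring.
  by have [xy|yx] := leP (u x) (u y); [rewrite min_l|rewrite min_r]; lra.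
Qed.

Lemma fsupp_sub_level u t (W := [set x | u x != 0]) :
  fsupp u -> fsupp (fun x => u x - t * \1_W x).
Proof.
apply: sub_finite_set => x /=; apply: contra_neq => ux0.
rewrite ux0 indicE (_ : x \in W = false) ?mulr0 ?subrr//.
by apply/negbTE; rewrite notin_setE /W/= ux0 eqxx.
Qed.

(** Coarea argument: the inequality is linear on functions whose superlevel sets
    are nested, so it follows from the sparseness of the superlevel sets. Here
    the minimal value of [u] on its support is split off. *)
Lemma deg_le_coarea_energy a k tau u : 0 <= a -> magnetic_sparse G 1 a k ->
  (forall x, cmod (tau x) = 1) -> fsupp u -> (forall x, 0 <= u x) ->
  pairing G (edge_Deg G) u <= (1 + a) * coarea_energy tau u +
    a * pairing G (qpos G) u + k * pairing G (fun=> 1) u.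
Proof.
move=> a0 /magnetic_sparseE sp t1.
have [n] := ubnP (#|` fset_set [set x | u x != 0]|); elim: n u => // n IH u.
rewrite ltnS => un fu u0; set W := [set x | u x != 0] in un fu *.
have [W0|] := eqVneq W set0.
  have u00 : u =1 fun=> 0.
    by move=> x; apply/eqP/negPn/negP => ux; have : W x by []; rewrite W0.
  have p0 g : pairing G g u = 0.
    by rewrite /pairing fsbig1// => x _; rewrite u00 mulr0 mul0r.
  rewrite !p0 !mulr0 !addr0 mulr_ge0//; first lra.
  by rewrite fine_ge0// edge_sum_ge0// => x y; exact: coarea_density_ge0.
move=> /set0P[x0 Wx0].
have Ws x : (x \in fset_set W) = (u x != 0) by rewrite in_fset_set// mem_setE.
have [|z zW zmin] := @seq_argmin (fset_set W) u.
  apply/eqP => s0; have : x0 \in (fset_set W : seq X) by have := Ws x0; rewrite Wx0.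
  by rewrite s0.
rewrite Ws in zW.
pose t := u z; have t0 : 0 <= t by exact: u0.
pose v x := u x - t * \1_W x.
have tW x : W x -> t <= u x by move=> Wx; apply: zmin; rewrite Ws.
have vz : v z = 0.
  by rewrite /v indicE mem_set// mulr1 subrr.
have v0 x : 0 <= v x.
  rewrite /v indicE; case: (boolP (x \in W)) => [/set_mem/tW|_].
    by rewrite mulr1 subr_ge0.
  by rewrite mulr0 subr0.
have fv : fsupp v by exact: fsupp_sub_level.
have vW : [set x | v x != 0] `<=` W.
  move=> x /=; apply: contra_neq; rewrite /v => ux0.
  rewrite ux0 indicE (_ : x \in W = false) ?mulr0 ?subrr//.
  by apply/negbTE; rewrite notin_setE /W/= ux0 eqxx.
have /IH/(_ fv v0) IHv : (#|` fset_set [set x | v x != 0%R]| < n)%N.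
  apply: leq_trans un; apply: fproper_ltn_card; rewrite fproperE; apply/andP; split.
    by apply/fsubsetP => x; rewrite Ws in_fset_set// mem_setE => /(vW x).
  apply/negP => /fsubsetP/(_ z); rewrite Ws zW => /(_ isT).
  by rewrite (in_fset_set (fv : finite_set _)) => /set_mem/=; rewrite vz eqxx.
have fI := fsupp_indic (fu : finite_set W).
have pE g : pairing G g u = t * pairing G g \1_W + pairing G g v.
  rewrite -pairingZr// -pairingDr//; last exact: fsuppZ.
  by apply: eq_fsbigr => x _; rewrite /v addrC subrK.
have cE : coarea_energy tau u = t * coarea_energy tau \1_W + coarea_energy tau v.
  apply: EFin_inj; rewrite EFinD EFinM -!coarea_energyE//; try by move=> x; rewrite indic_ge0.
  rewrite -edge_sumZ//; last by move=> x y; apply: coarea_density_ge0; exact: indic_ge0.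
  rewrite -edge_sumD.
  - by apply: eq_edge_sum => x y; apply: coarea_density_level => //; exact: u0.
  - move=> x y; rewrite mulr_ge0//.
    by apply: coarea_density_ge0; exact: indic_ge0.
  - by move=> x y; exact: coarea_density_ge0.
rewrite !pE cE.
have IW : pairing G (edge_Deg G) \1_W <= (1 + a) * coarea_energy tau \1_W +
    a * pairing G (qpos G) \1_W + k * pairing G (fun=> 1) \1_W.
  have [_ _ ->] := weights_fin G fu.
  rewrite coarea_energy_indic//.
  have := sp W fu; have := frustration_index_le G 1 (fun x (_ : W x) => t1 x) => fr S.
  have : (1 + a) * frustration_index G 1 W <= (1 + a) * frustration G 1 tau W.
    by apply: ler_wpM2l => //; lra.
  lra.
have := ler_wpM2l t0 IW.
move: IHv; lra.
Qed.

(** Summing [coarea_edge_le] over the edges; the potential term is absorbed with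
    Bernoulli's inequality [1 + p a <= (1 + a)^p]. *)
Lemma deg_norm_le_of_sparse p a k f : 1 <= p -> 0 <= a -> 0 <= k ->
  magnetic_sparse G 1 a k -> Cc f ->
  deg_norm G p f <= hardy_const p a * pos_energy G p f + p * k * mass_norm G p f.
Proof.
move=> p1 a0 k0 sp fc; have p0 : 0 < p by lra.
have fu : fsupp (modpow p f) by apply: fsupp_modpow; rewrite ?gt_eqF.
have u0 : forall x, 0 <= modpow p f x := modpow_ge0 p f.
pose tau x := phase (f x); have t1 x : cmod (tau x) = 1 by exact: cmod_phase.
have := deg_le_coarea_energy a0 sp t1 fu u0.
have := hardy_const_gt p1 a0; have := bernoulli_powR p1 a0.
rewrite deg_normE// /pos_energy /mass_norm.
have V0 : 0 <= pairing G (qpos G) (modpow p f) by apply: pairing_ge0 => //; exact: qpos_ge0.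
set D := hardy_const p a => A1 A2.
have D0 : 0 <= D by nra.
have : p * (1 + a) * coarea_energy tau (modpow p f) <= D * grad_energy G p f
    + (p - 1) * pairing G (edge_Deg G) (modpow p f).
  have pa0 : 0 <= p * (1 + a) by rewrite mulr_ge0//; lra.
  rewrite -lee_fin EFinD !EFinM -coarea_energyE// -grad_energyE// -edge_sum_vertex//.
  rewrite -EFinM -!edge_sumZ//; [|lra|move=> x y; rewrite addr_ge0//
    |exact: grad_ge0|by move=> x y; exact: coarea_density_ge0].
  rewrite -edge_sumD; last 2 first.
  - by move=> x y; rewrite mulr_ge0// grad_ge0.
  - by move=> x y; apply: mulr_ge0; [lra|exact: addr_ge0].
  apply: le_edge_sum => x y.
  have := @coarea_edge_le R p a (cmod (f x)) (cmod (f y)) (tau x)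
    (expi (theta x y) * tau y) p1 a0 (cmod_ge0 _) (cmod_ge0 _) (t1 x).
  rewrite cmodM cmod_expi t1 mulr1 => /(_ erefl).
  by rewrite mulrCA !phaseK.
move: V0; move: (pairing G (qpos G) _) => V.
move: (pairing G (edge_Deg G) _) => T.
move: (pairing G _ _) (grad_energy _ _ _) (coarea_energy _ _) => N E C.
move=> V0 A3 A4.
have A5 : p * T <= p * ((1 + a) * C + a * V + k * N) by apply: ler_wpM2l => //; lra.
have : (1 + p * a) * V <= D * V by apply: ler_wpM2r => //; lra.
lra.
Qed.

End Coarea.

(** * From lower bounds of the energy to sparseness *)

Section SparseConverse.
Context {R : realType} {X : choiceType}.
Variable G : magnetic_graph R X.
Implicit Types (f tau : X -> R[i]) (p a k : R) (W : set X).

Local Notation b := (edge_weight G).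
Local Notation theta := (magnetic_potential G).

Section CutOff.
Variables (p : R) (tau : X -> R[i]) (W : set X).
Hypotheses (p0 : 0 < p) (fW : finite_set W).
Hypothesis t1 : forall x, W x -> cmod (tau x) = 1.

Definition cut_off (x : X) : R[i] := if x \in W then tau x else 0.

Lemma cut_off_Cc : Cc cut_off.
Proof.
apply: sub_finite_set fW => x /=; rewrite /cut_off.
by case: ifPn => [/set_mem//|]; rewrite eqxx.
Qed.

Lemma modpow_cut_off : modpow p cut_off = \1_W.
Proof.
apply/funext => x; rewrite /modpow /cut_off indicE.
case: ifPn => [/set_mem/t1 ->|_]; first by rewrite powR1.
by rewrite cmod0 powR0// gt_eqF.
Qed.

(** Inside [W] only the twist of the phases is seen; across the boundary the
    function jumps from modulus [1] to [0]. *)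
Lemma grad_energy_cut_off :
  grad_energy G p cut_off = boundary_weight G W + frustration G p tau W.
Proof.
rewrite /grad_energy (@eq_edge_sum _ _ _ _ (fun x y => `|\1_W x - \1_W y| +
  Num.min (\1_W x) (\1_W y) * twist G tau x y `^ p)).
  by rewrite edge_sum_cut// => x y; exact: powR_ge0.
move=> x y; rewrite /grad /cut_off !indicE.
have m0 : Num.min 0 1 = 0 :> R by rewrite min_l.
have m1 : Num.min 1 0 = 0 :> R by rewrite min_r.
have z0 : cmod (0 - expi (theta x y) * 0) = 0 by rewrite mulr0 subr0 cmod0.
case: ifPn => [/set_mem/t1 tx|_]; case: ifPn => [/set_mem/t1 ty|_]; rewrite ?z0 /=.
- by rewrite subrr normr0 add0r minxx mul1r.
- by rewrite mulr0 subr0 tx powR1 subr0 normr1 m1 mul0r addr0.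
- by rewrite sub0r cmodN cmodM cmod_expi ty mul1r powR1 sub0r normrN normr1 m0 mul0r addr0.
- by rewrite powR0 ?gt_eqF// subrr normr0 minxx mul0r addr0.
Qed.

End CutOff.

(** Testing the lower bound with the functions that have modulus [1] on [W] and
    vanish elsewhere, and taking the infimum over their phases. *)
Lemma sparse_of_Deg_bound p a k : 0 < p -> 0 <= a -> a < 1 -> 0 <= k ->
  Deg_bound G p a k -> magnetic_sparse G p ((1 - a)^-1 - 1) (k / (1 - a)).
Proof.
move=> p0 a0 a1 k0 /(Deg_boundE _ _ _ p0) H; apply/magnetic_sparseE => W fW.
set I := frustration_index G p W; set w := inner_weight G W.
set B := boundary_weight G W + _; set N := pairing G _ _.
suff wI : (1 - a) * w - a * B - k * N <= I.
  rewrite -(@ler_pM2l _ (1 - a)); last lra.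
  rewrite [leRHS](_ : _ = I + a * B + k * N); first lra.
  by field; lra.
apply: le_frustration_index => tau t1.
have := H _ (cut_off_Cc tau fW).
have Cf := cut_off_Cc tau fW.
have M0 := neg_norm_ge0 G p (cut_off tau W).
rewrite deg_normE// /pos_energy /mass_norm grad_energy_cut_off//.
rewrite !modpow_cut_off//.
have [_ _ ->] := weights_fin G fW.
rewrite -/N -/w /B; move: M0; move: (neg_norm _ _ _) (frustration _ _ _ _) => M F.
have := mulr_ge0 a0; nra.
Qed.

Lemma boundary_potential_ge0 W :
  0 <= boundary_weight G W + pairing G (qpos G) \1_W.
Proof.
apply: addr_ge0.
  apply: fine_ge0; apply: mule_ge0; first by rewrite lee_fin.
  by apply: esum_ge0 => z _; rewrite lee_fin edge_weight_ge0.
by apply: pairing_ge0 => x; [exact: qpos_ge0|exact: indic_ge0].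
Qed.

Lemma magnetic_sparse_le p a a' k : a <= a' ->
  magnetic_sparse G p a k -> magnetic_sparse G p a' k.
Proof.
move=> aa' /magnetic_sparseE H; apply/magnetic_sparseE => W fW.
apply: (le_trans (H W fW)); rewrite lerD2r; apply: lerD; apply: ler_wpM2r.
- exact: frustration_index_ge0.
- by rewrite lerD2l.
- exact: boundary_potential_ge0.
- by [].
Qed.

(** Distances of unimodular numbers are at most [2], hence
    [|z - w|^p <= 2^(p-1) |z - w|]. *)
Lemma frustration_index_le1 p W : 1 <= p -> finite_set W ->
  frustration_index G p W <= 2 `^ (p - 1) * frustration_index G 1 W.
Proof.
move=> p1 fW; have c0 : 0 < 2 `^ (p - 1) :> R by rewrite powR_gt0.
rewrite mulrC -ler_pdivrMr//; apply: le_frustration_index => tau t1.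
rewrite ler_pdivrMr//; apply: le_trans (frustration_index_le G p t1) _.
rewrite /frustration -mulrA ler_pM2l ?invr_gt0// mulr_fsuml.
rewrite !fsbig_finite// !big_seq; apply: ler_sum => x.
rewrite in_fset_set// => /set_mem Wx; rewrite mulr_fsuml.
rewrite !fsbig_finite// !big_seq; apply: ler_sum => y.
rewrite in_fset_set// => /set_mem Wy.
rewrite -mulrA ler_wpM2l ?edge_weight_ge0//.
have t0 : 0 <= twist G tau x y by exact: cmod_ge0.
have t2 := twist_le2 G (t1 x Wx) (t1 y Wy).
rewrite powRr1// -(@mulr_powRB1 _ _ p)//; last lra.
by rewrite ler_wpM2l// ge0_ler_powR// ?nnegrE//; lra.
Qed.

Lemma magnetic_sparse1 p a k : 1 <= p -> 0 <= a ->
  magnetic_sparse G p a k -> magnetic_sparse G 1 ((1 + a) * 2 `^ (p - 1) - 1) k.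
Proof.
move=> p1 a0 H; have c1 : 1 <= 2 `^ (p - 1) :> R.
  by rewrite -[leLHS](powRr0 2) ler_powR; lra.
have aa : a <= (1 + a) * 2 `^ (p - 1) - 1 by nra.
move: H => /magnetic_sparseE H; apply/magnetic_sparseE => W fW.
apply: (le_trans (H W fW)); rewrite lerD2r; apply: lerD.
  rewrite (_ : 1 + (_ - 1) = (1 + a) * 2 `^ (p - 1)); last by ring.
  by rewrite -mulrA ler_wpM2l ?frustration_index_le1//; lra.
exact: ler_wpM2r (boundary_potential_ge0 _) _ _ aa.
Qed.

End SparseConverse.

(** * Weighted sums of squares *)

Section WeightedSquares.
Context {R : realType} {X : choiceType}.
Implicit Types (w : X -> R) (f g h : X -> R[i]) (A : set X).

Lemma Cc_sub f g h : Cc f -> Cc g ->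
  (forall x, f x = 0 -> g x = 0 -> h x = 0) -> Cc h.
Proof.
move=> fc gc H; apply: (@sub_finite_set _ _ ([set x | f x != 0] `|` [set x | g x != 0])).
  move=> x /= hx; have [fx|fx] := eqVneq (f x) 0; last by left.
  right; apply: contra_neq hx => gx; exact: H.
by rewrite finite_setU.
Qed.

Lemma CcD f g : Cc f -> Cc g -> Cc (f \+ g).
Proof. by move=> fc gc; apply: (Cc_sub fc gc) => x /= -> ->; rewrite addr0. Qed.

Lemma CcB f g : Cc f -> Cc g -> Cc (f \- g).
Proof. by move=> fc gc; apply: (Cc_sub fc gc) => x /= -> ->; rewrite subr0. Qed.

Definition scale (c : R) f : X -> R[i] := fun x => Complex c 0 * f x.

Lemma Cc_scale c f : Cc f -> Cc (scale c f).
Proof. by move=> fc; apply: (Cc_sub fc fc) => x fx _; rewrite /scale fx mulr0. Qed.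

Lemma sqr_cmod_scale (c : R) (z : R[i]) : cmod (Complex c 0 * z) ^+ 2 = c ^+ 2 * cmod z ^+ 2.
Proof. by rewrite cmodM exprMn cmod_real real_normK// num_real. Qed.

Lemma scaleN1 f g : scale (-1) (f \- g) = g \- f.
Proof.
apply/funext => x; rewrite /scale/=.
have -> : Complex (-1) 0 = -1 :> R[i] by apply/eqP; rewrite eq_complex/= oppr0 !eqxx.
by rewrite mulN1r opprB.
Qed.

Lemma modpow2E f x : modpow 2 f x = cmod (f x) ^+ 2.
Proof. by rewrite /modpow powR_mulrn// cmod_ge0. Qed.

Definition wsum w A f : \bar R := (\esum_(x in A) (cmod (f x) ^+ 2 * w x)%:E)%E.

Section Weight.
Variables (w : X -> R) (w0 : forall x, 0 <= w x).

Lemma wsum_term_ge0 f x : (0 <= (cmod (f x) ^+ 2 * w x)%:E)%E.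
Proof. by rewrite lee_fin mulr_ge0 ?sqr_ge0. Qed.

Lemma wsum_ge0 A f : (0 <= wsum w A f)%E.
Proof. by apply: esum_ge0 => x _; exact: wsum_term_ge0. Qed.

Lemma wsumD_le A f g : (wsum w A (f \+ g)%R <= 2%:E * wsum w A f + 2%:E * wsum w A g)%E.
Proof.
rewrite /wsum -!esumZl//; try by move=> x; exact: wsum_term_ge0.
rewrite -esumD; try by move=> x _; rewrite mule_ge0 ?wsum_term_ge0 ?lee_fin.
apply: le_esum => x _; rewrite -!EFinM -EFinD lee_fin /= 2!(mulrA 2 _ (w x)) -mulrDl ler_wpM2r//.
exact: sqr_cmodD_le.
Qed.

Lemma wsumBC A f g : wsum w A (f \- g) = wsum w A (g \- f).
Proof. by apply: eq_esum => x _ /=; rewrite cmod_distC. Qed.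

Lemma le_wsum_set A f : (wsum w A f <= wsum w setT f)%E.
Proof.
rewrite /wsum esum_mkcond; apply: le_esum => x _.
by case: ifPn => // _; exact: wsum_term_ge0.
Qed.

Lemma wsum_split A f : (wsum w setT f = wsum w A f + wsum w (~` A) f)%E.
Proof.
rewrite {1}/wsum (esumID A) ?setTI// => x _.
exact: wsum_term_ge0.
Qed.

Lemma wsum_le_fin f (c : R) :
  (forall A, finite_set A -> (wsum w A f <= c%:E)%E) -> (wsum w setT f <= c%:E)%E.
Proof.
move=> H; apply: ge_ereal_sup => _ [A [fA _] <-].
apply: le_trans (H A fA); rewrite /wsum esum_fset// => x _.
exact: wsum_term_ge0.
Qed.

Lemma wsum_tail f : (wsum w setT f < +oo)%E -> forall e : R, 0 < e ->
  exists2 A, finite_set A & (wsum w (~` A) f <= e%:E)%E.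
Proof.
move=> f_fin e e0.
have wfin : wsum w setT f \is a fin_num by rewrite ge0_fin_numE ?wsum_ge0.
have [_ [A [fA _] <-] HA] := ub_ereal_sup_adherent e0 wfin.
exists A => //; rewrite -esum_fset// in HA; last by move=> x _; exact: wsum_term_ge0.
have As := wsum_split A f.
have {}HA : (wsum w setT f - e%:E < wsum w A f)%E := HA.
have Afin : wsum w A f \is a fin_num.
  by rewrite ge0_fin_numE ?wsum_ge0// (le_lt_trans (le_wsum_set A f)).
have Bfin : wsum w (~` A) f \is a fin_num.
  by rewrite ge0_fin_numE ?wsum_ge0// (le_lt_trans (le_wsum_set _ f)).
rewrite As in HA.
move: HA Afin Bfin; case: (wsum w A f) => [r||]//; case: (wsum w (~` A) f) => [s||]//.
by move=> + _ _; rewrite -!EFinD lte_fin lee_fin; lra.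
Qed.

End Weight.

Lemma wsum_le_weight w w' A (c : R) f : 0 <= c -> (forall x, 0 <= w' x) ->
  (forall x, A x -> w x <= c * w' x) -> (wsum w A f <= c%:E * wsum w' A f)%E.
Proof.
move=> c0 w'0 ww'; rewrite /wsum -esumZl// => [|x]; last exact: wsum_term_ge0.
apply: le_esum => x Ax; rewrite -EFinM lee_fin mulrCA ler_wpM2l ?sqr_ge0//.
exact: ww'.
Qed.

End WeightedSquares.

(** * The energy as a quadratic form *)

Section QuadraticForms.
Context {R : realType} {X : choiceType}.
Variable G : magnetic_graph R X.
Implicit Types (f g h : X -> R[i]).

Local Notation m := (vertex_measure G).
Local Notation P := (pos_energy G 2).
Local Notation N := (mass_norm G 2).
Local Notation S := (deg_norm G 2).

Lemma vertex_measure_ge0 x : 0 <= m x. Proof. by rewrite ltW// vertex_measure_gt0. Qed.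

Lemma deg_plusE x : deg_plus G x = Degpos G x * m x.
Proof.
rewrite /deg_plus /deg /Degpos mulrDl /edge_Deg mulrAC mulVf ?gt_eqF ?vertex_measure_gt0//.
rewrite mul1r -addrA -mulrDl; congr (_ + _ * _).
by rewrite potentialE /qneg subrK.
Qed.

Lemma deg_plus_ge0 x : 0 <= deg_plus G x.
Proof. by rewrite deg_plusE mulr_ge0 ?Degpos_ge0 ?vertex_measure_ge0. Qed.

Lemma pairing2_wsum (g : X -> R) f : (forall x, 0 <= g x) -> Cc f ->
  (pairing G g (modpow 2 f))%:E = wsum (fun x => g x * m x) setT f.
Proof.
move=> g0 fc; rewrite pairing_esum//.
- by apply: eq_esum => x _; rewrite modpow2E mulrAC mulrC.
- exact: fsupp_modpow.
- exact: modpow_ge0.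
Qed.

Lemma mass_norm_wsum f : Cc f -> (N f)%:E = wsum m setT f.
Proof.
move=> fc; rewrite pairing2_wsum//; apply: eq_esum => x _; by rewrite mul1r.
Qed.

Lemma deg_norm_wsum f : Cc f -> (S f)%:E = wsum (deg_plus G) setT f.
Proof.
move=> fc; rewrite pairing2_wsum//; last exact: Degpos_ge0.
by apply: eq_esum => x _; rewrite deg_plusE.
Qed.

Lemma pairing2D (g : X -> R) f h : (forall x, 0 <= g x) -> Cc f -> Cc h ->
  pairing G g (modpow 2 (f \+ h)) <=
  2 * pairing G g (modpow 2 f) + 2 * pairing G g (modpow 2 h).
Proof.
move=> g0 fc hc; rewrite -lee_fin EFinD !EFinM !pairing2_wsum//; last exact: CcD.
by apply: wsumD_le => x; rewrite mulr_ge0 ?vertex_measure_ge0.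
Qed.

Lemma grad2E f x y : grad G 2 f x y =
  cmod (f x - expi (magnetic_potential G x y) * f y) ^+ 2.
Proof. by rewrite /grad powR_mulrn// cmod_ge0. Qed.

Lemma grad_energy2D f h : Cc f -> Cc h ->
  grad_energy G 2 (f \+ h) <= 2 * grad_energy G 2 f + 2 * grad_energy G 2 h.
Proof.
move=> fc hc; rewrite -lee_fin EFinD !EFinM -!grad_energyE//; last exact: CcD.
rewrite -!edge_sumZ//; try exact: grad_ge0.
rewrite -edge_sumD; try by move=> x y; rewrite mulr_ge0// grad_ge0.
apply: le_edge_sum => x y; rewrite !grad2E /=.
rewrite mulrDr opprD addrACA; exact: sqr_cmodD_le.
Qed.

Lemma grad_energy2Z (c : R) f : Cc f ->
  grad_energy G 2 (scale c f) = c ^+ 2 * grad_energy G 2 f.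
Proof.
move=> fc; apply: EFin_inj; rewrite EFinM -!grad_energyE//; last exact: Cc_scale.
rewrite -edge_sumZ ?sqr_ge0//; last exact: grad_ge0.
apply: eq_edge_sum => x y; rewrite !grad2E /scale mulrCA -mulrBr.
exact: sqr_cmod_scale.
Qed.

Lemma pairing2Z (c : R) (g : X -> R) f : Cc f ->
  pairing G g (modpow 2 (scale c f)) = c ^+ 2 * pairing G g (modpow 2 f).
Proof.
move=> fc; rewrite -pairingZr; last exact: fsupp_modpow.
by congr (pairing G g _); apply/funext => x; rewrite !modpow2E sqr_cmod_scale.
Qed.

Lemma deg_norm2D f h : Cc f -> Cc h -> S (f \+ h) <= 2 * S f + 2 * S h.
Proof. by move=> *; apply: pairing2D => // x; exact: Degpos_ge0. Qed.

Lemma deg_norm2Z (c : R) f : Cc f -> S (scale c f) = c ^+ 2 * S f.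
Proof. exact: pairing2Z. Qed.

(** By the smallness of [q_-] this is equivalent to the square of the form norm
    of the energy, and unlike the latter it is a sum of non-negative terms. *)
Definition form_norm f : R := P f + N f.

Lemma form_norm_ge0 f : 0 <= form_norm f.
Proof. by rewrite addr_ge0 ?pos_energy_ge0 ?mass_norm_ge0. Qed.

Lemma form_normD f h : Cc f -> Cc h ->
  form_norm (f \+ h) <= 2 * form_norm f + 2 * form_norm h.
Proof.
move=> fc hc; rewrite /form_norm /pos_energy.
have := grad_energy2D fc hc; have := pairing2D (qpos_ge0 G) fc hc.
have := pairing2D (fun=> ler01 : 0 <= 1 :> R) fc hc; rewrite /mass_norm; lra.
Qed.

Lemma form_normZ (c : R) f : Cc f -> form_norm (scale c f) = c ^+ 2 * form_norm f.
Proof.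
move=> fc; rewrite /form_norm /pos_energy /mass_norm grad_energy2Z// !pairing2Z//.
ring.
Qed.

Lemma form_normBC f h : Cc f -> Cc h -> form_norm (f \- h) = form_norm (h \- f).
Proof.
move=> fc hc; rewrite -(scaleN1 f h) form_normZ ?sqrrN ?expr1n ?mul1r//.
exact: CcB.
Qed.

End QuadraticForms.

(** * The form domain under a lower bound *)

Section FormDomain.
Context {R : realType} {X : choiceType}.
Variable G : magnetic_graph R X.
Variable alpha : R.
Hypothesis alpha1 : alpha < 1.
Hypothesis hq : form_small G 2 alpha.
Implicit Types (f g h : X -> R[i]).

Local Notation m := (vertex_measure G).
Local Notation P := (pos_energy G 2).
Local Notation N := (mass_norm G 2).
Local Notation S := (deg_norm G 2).

Lemma lpnorm2E f : lpnorm G 2 f = (wsum m setT f `^ 2^-1)%E.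
Proof.
by congr (_ `^ _)%E; apply: eq_esum => x _; rewrite modpow2E.
Qed.

Lemma finite_bound (A : set X) (g : X -> R) : finite_set A -> (forall x, 0 <= g x) ->
  exists2 c : R, 0 <= c & forall x, A x -> g x <= c.
Proof.
move=> fA g0; exists (\sum_(x <- fset_set A) g x); first by apply: sumr_ge0.
move=> x Ax; rewrite (big_fsetD1 x)/=; last by rewrite in_fset_set// mem_set.
by rewrite lerDl sumr_ge0.
Qed.

Lemma mass_norm_distle f F1 F2 (c d : R) : Cc F1 -> Cc F2 ->
  (wsum m setT (F1 \- f)%R <= c%:E)%E -> (wsum m setT (F2 \- f)%R <= d%:E)%E ->
  N (F1 \- F2) <= 2 * c + 2 * d.
Proof.
move=> c1 c2 H1 H2; rewrite -lee_fin mass_norm_wsum; last exact: CcB.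
have -> : F1 \- F2 = ((F1 \- f) \+ (f \- F2))%R.
  by apply/funext => x /=; rewrite addrA subrK.
apply: le_trans (wsumD_le (vertex_measure_ge0 G) _ _ _) _.
rewrite (EFinD (2 * c)) !EFinM leeD// lee_wpmul2l ?lee_fin//.
by rewrite wsumBC.
Qed.

(** Finite-support approximation in the form norm and in the [l^2] norm puts [f] in
    the form domain: the energy of a difference lies between [- C] and [1] times
    its form norm, with [C] the constant in the smallness of [q_-]. *)
Lemma form_domainI f (F : nat -> X -> R[i]) (e : nat -> R) :
  (forall n, Cc (F n)) -> e @ \oo --> 0 ->
  (forall n, (wsum m setT (F n \- f)%R <= (e n)%:E)%E) ->
  (forall n k, form_norm G (F n \- F k) <= e n + e k) ->
  form_domain G f.
Proof.
move=> Fc e_cvg HN HB; have [C C0 HC] := (form_smallE G alpha (ltr0n _ 2)).1 hq.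
have e0 n : 0 <= e n.
  by rewrite -lee_fin (le_trans _ (HN n))// wsum_ge0//; exact: vertex_measure_ge0.
split.
  rewrite /ell2/=; apply: (@le_lt_trans _ _ (2%:E * (N (F 0%N))%:E + 2%:E * (e 0%N)%:E)%E).
    rewrite -[X in (X <= _)%E]/(wsum m setT f).
    have -> : f = (F 0%N \+ (f \- F 0%N))%R by apply/funext => x /=; rewrite addrC subrK.
    apply: le_trans (wsumD_le (vertex_measure_ge0 G) _ _ _) _.
    rewrite mass_norm_wsum// leeD// lee_wpmul2l ?lee_fin//.
    by rewrite wsumBC.
  by rewrite -!EFinM -EFinD ltry.
exists F; split=> //.
- apply: (@squeeze_cvge _ _ _ _ (cst 0%E) _ (fun n => (Num.sqrt (e n))%:E)).
  + near=> n; rewrite lpnorm2E poweR_ge0/= -powR12_sqrt// -poweR_EFin.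
    apply: gt0_ler_poweR; rewrite ?in_itv/= ?leey ?andbT ?lee_fin ?invr_ge0//.
    by apply: wsum_ge0; exact: vertex_measure_ge0.
  + exact: cvg_cst.
  + apply: cvg_EFin; first by near=> n.
    rewrite -[X in _ --> X](sqrtr0 R).
    exact: (continuous_cvg _ (@sqrt_continuous R 0)).
- apply: cvg_EFin.
    by near=> nk; rewrite energyE//; exact: CcB.
  apply/cvgrPdist_le => eps eps0.
  pose d := eps / (2 * (1 + C)).
  have d0 : 0 < d by rewrite divr_gt0//; lra.
  have /cvgrPdist_le/(_ d d0) ed := e_cvg.
  exists ([set n | `|0 - e n| <= d], [set n | `|0 - e n| <= d]) => //.
  move=> [n k] [/= ]; rewrite !sub0r !normrN !(ger0_norm (e0 _)) => en ek.
  have Fnk : Cc (F n \- F k) by exact: CcB.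
  rewrite energyE//=.
  have HM := HC _ Fnk; have := HB n k; rewrite /form_norm.
  have := mass_norm_ge0 G 2 (F n \- F k); have := pos_energy_ge0 G 2 (F n \- F k).
  have := neg_norm_ge0 G 2 (F n \- F k).
  move: HM; move: (neg_norm _ _ _) (mass_norm _ _ _) (pos_energy _ _ _) => M' N' P'.
  move=> HM M0 N0 P0 B.
  have dE : (1 + C) * (2 * d) = eps by rewrite /d; field; lra.
  have : (1 + C) * (P' + N') <= eps by rewrite -dE ler_wpM2l//; lra.
  have : 0 <= C * P' by rewrite mulr_ge0.
  have : 0 <= C * N' by rewrite mulr_ge0.
  have : alpha * P' <= 1 * P' by rewrite ler_wpM2r// ltW.
  by rewrite ler_norml; lra.
Unshelve. all: by end_near. Qed.

Lemma lpnorm_cvg0_near f (F : nat -> X -> R[i]) :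
  lpnorm G 2 (F n \- f) @[n --> \oo] --> 0%E -> forall e : R, 0 < e ->
  \forall n \near \oo, (wsum m setT (F n \- f)%R <= e%:E)%E.
Proof.
move=> H e e0; have s0 : 0 < Num.sqrt e by rewrite sqrtr_gt0.
have : (0%E < (Num.sqrt e)%:E)%E by rewrite lte_fin.
move=> /open_ereal_lt'/H Hn.
apply: (@filterS _ \oo _ (fun n => (lpnorm G 2 (F n \- f)%R < (Num.sqrt e)%:E)%E));
  last exact: Hn.
move=> n /=.
rewrite lpnorm2E leNgt => He; apply/negP => {}/ltW eN.
have : ((e%:E) `^ 2^-1 <= wsum m setT (F n \- f)%R `^ 2^-1)%E.
  apply: gt0_ler_poweR => //; rewrite ?in_itv/= ?leey ?andbT ?lee_fin ?(ltW e0)//.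
  by apply: wsum_ge0; exact: vertex_measure_ge0.
by rewrite poweR_EFin powR12_sqrt ?(ltW e0)// leNgt He.
Qed.

Section Bound.
Variable K : R.
Hypothesis K0 : 0 <= K.
Hypothesis HK : forall f, Cc f -> S f <= K * (P f + N f).

(** The approximating sequence is Cauchy for the energy, hence bounded in the
    degree norm; finite partial sums of [f] inherit the bound from the [l^2]
    limit, since the degree is bounded on a finite set. *)
Lemma form_domain_sub : form_domain G `<=` ell2 (deg_plus G) `&` ell2 m.
Proof.
move=> f [fm [F [Fc FN FQ]]]; split => //; have [C C0 HC] := (form_smallE G alpha (ltr0n _ 2)).1 hq.
have : (0 < 1 :> \bar R)%E by rewrite lte_fin.
move=> /open_ereal_lt'/FQ [[A B] [/= oA oB] AB].
have [k [Bk Nk]] : exists k, B k /\ (wsum m setT (F k \- f)%R <= 1%:E)%E.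
  apply: (@filter_ex _ \oo); apply: filterI => //.
  by apply: lpnorm_cvg0_near.
pose L := 2 * (K * ((1 + 4 * C) / (1 - alpha) + 4)) + 2 * S (F k).
have HL n : A n -> (wsum m setT (F n \- f)%R <= 1%:E)%E -> S (F n) <= L.
  move=> An Nn; have Fnk : Cc (F n \- F k) by exact: CcB.
  have : (energy G 2 (F n \- F k)%R < 1)%E by exact: (AB (n, k)).
  rewrite energyE// lte_fin => En.
  have N4 : N (F n \- F k) <= 4 by have := mass_norm_distle (Fc n) (Fc k) Nn Nk; lra.
  have CN4 : C * N (F n \- F k) <= C * 4 by exact: ler_wpM2l.
  have PE : P (F n \- F k) <= (1 + 4 * C) / (1 - alpha).
    rewrite ler_pdivlMr ?subr_gt0//.
    move: En (HC _ Fnk) CN4; move: (neg_norm _ _ _) (mass_norm _ _ _) (pos_energy _ _ _).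
    move=> *; lra.
  have -> : F n = ((F n \- F k) \+ F k)%R by apply/funext => x /=; rewrite subrK.
  apply: le_trans (deg_norm2D G Fnk (Fc k)) _.
  rewrite lerD2r ler_pM2l//; apply: le_trans (HK Fnk) _.
  by rewrite ler_wpM2l// lerD.
rewrite /ell2/=; apply: (@le_lt_trans _ _ (2 * L + 2)%:E); last exact: ltry.
apply: (@wsum_le_fin _ _ _ (deg_plus_ge0 G)) => E fE.
have [c c0 Ec] := finite_bound fE (Degpos_ge0 G).
have [n [[An N1] Nc]] : exists n, (A n /\ (wsum m setT (F n \- f)%R <= 1%:E)%E) /\
    (wsum m setT (F n \- f)%R <= ((c + 1)^-1)%:E)%E.
  apply: (@filter_ex _ \oo); apply: filterI; first apply: filterI => //.
  - by apply: lpnorm_cvg0_near.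
  - by apply: lpnorm_cvg0_near => //; rewrite invr_gt0; lra.
have -> : f = (F n \+ (f \- F n))%R by apply/funext => x /=; rewrite addrC subrK.
apply: le_trans (wsumD_le (deg_plus_ge0 G) _ _ _) _.
rewrite (EFinD (2 * L)) EFinM leeD//.
  rewrite lee_wpmul2l ?lee_fin//; apply: le_trans (le_wsum_set (deg_plus_ge0 G) _ _) _.
  by rewrite -deg_norm_wsum// lee_fin; exact: HL.
rewrite -[X in (_ <= X)%E]mule1 lee_wpmul2l ?lee_fin//.
rewrite wsumBC; apply: (@le_trans _ _ (c%:E * wsum m E (F n \- f)%R)%E).
  apply: wsum_le_weight => //; first exact: vertex_measure_ge0.
  by move=> x Ex; rewrite deg_plusE ler_wpM2r ?vertex_measure_ge0// Ec.
apply: (@le_trans _ _ (c%:E * ((c + 1)^-1)%:E)%E).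
  apply: lee_wpmul2l; first by rewrite lee_fin.
  exact: le_trans (le_wsum_set (vertex_measure_ge0 G) _ _) Nc.
rewrite -EFinM lee_fin ler_pdivrMr; lra.
Qed.

End Bound.

(** This rests on the elementary bound [|z - w|^2 <= 4 (|z|^2 + |w|^2)]. *)
Lemma form_norm_le f : Cc f -> form_norm G f <= 4 * S f + N f.
Proof.
move=> fc; rewrite /form_norm lerD2r /pos_energy deg_normE//.
have := @grad_energy_le _ _ G 2 f (ltr0n _ 2) fc.
rewrite (_ : 2 `^ 2 = 4); last by rewrite powR_mulrn// expr2 -natrM.
have : 0 <= pairing G (qpos G) (modpow 2 f).
  by apply: pairing_ge0 => x; [exact: qpos_ge0|exact: modpow_ge0].
lra.
Qed.

(** Truncations to finite sets that carry all but [1 / (n + 1)] of the weighted sum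
    converge in both norms. *)
Lemma ell2_sub_form_domain : ell2 (deg_plus G) `&` ell2 m `<=` form_domain G.
Proof.
move=> f [fdeg fm].
pose w x := deg_plus G x + m x.
have w0 x : 0 <= w x by rewrite addr_ge0 ?deg_plus_ge0 ?vertex_measure_ge0.
have wfin : (wsum w setT f < +oo)%E.
  rewrite /wsum; under eq_esum do rewrite mulrDr EFinD.
  rewrite esumD; first exact: lte_add_pinfty.
  - by move=> x _; apply: wsum_term_ge0; exact: deg_plus_ge0.
  - by move=> x _; apply: wsum_term_ge0; exact: vertex_measure_ge0.
have HA n : exists A, finite_set A /\ (wsum w (~` A) f <= (harmonic n)%:E)%E.
  by have [A fA HA] := wsum_tail w0 wfin (harmonic_gt0 n); exists A.
have [A {HA}/all_and2[fA HA]] := choice HA.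
pose F n (x : X) : R[i] := if x \in A n then f x else 0.
have Fc n : Cc (F n).
  apply: sub_finite_set (fA n) => x /=; rewrite /F.
  by case: ifPn => [/set_mem//|]; rewrite eqxx.
have tail v n : (forall x, 0 <= v x) -> (forall x, v x <= w x) ->
    (wsum v setT (F n \- f)%R <= (harmonic n)%:E)%E.
  move=> v0 vw; apply: le_trans (HA n).
  rewrite /wsum [in leRHS]esum_mkcond; apply: le_esum => x _.
  rewrite in_setC /F /=; case: ifPn => _ /=.
    by rewrite subrr cmod0 expr0n mul0r.
  by rewrite sub0r cmodN lee_fin ler_wpM2l ?sqr_ge0.
have h0 n : 0 <= harmonic n :> R by exact: harmonic_ge0.
have mw x : m x <= w x by rewrite lerDr deg_plus_ge0.
have dw x : deg_plus G x <= w x by rewrite lerDl vertex_measure_ge0.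
have tm n := tail m n (vertex_measure_ge0 G) mw.
apply: (@form_domainI f F (fun n => 10 * harmonic n)) => //.
- rewrite -[X in _ --> X](mulr0 10); apply: cvgMr; exact: cvg_harmonic.
- by move=> n; apply: le_trans (tm n) _; rewrite lee_fin; have := h0 n; lra.
- move=> n k; have Fnk : Cc (F n \- F k) by exact: CcB.
  apply: le_trans (form_norm_le Fnk) _.
  have := mass_norm_distle (Fc n) (Fc k) (tm n) (tm k).
  have : S (F n \- F k) <= 2 * harmonic n + 2 * harmonic k.
    rewrite -lee_fin deg_norm_wsum//.
    have -> : F n \- F k = ((F n \- f) \+ (f \- F k))%R.
      by apply/funext => x /=; rewrite addrA subrK.
    apply: le_trans (wsumD_le (deg_plus_ge0 G) _ _ _) _.
    have td j := tail (deg_plus G) j (deg_plus_ge0 G) dw.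
    by rewrite (EFinD (2 * harmonic n)) !EFinM leeD// lee_wpmul2l ?lee_fin// wsumBC.
  have := h0 n; have := h0 k; lra.
Qed.

End FormDomain.

(** * Limits of complex sequences *)

Section Limits.
Context {R : realType}.

Lemma real_cauchy_limit (u d : nat -> R) : d @ \oo --> 0 ->
  (forall n k, (n <= k)%N -> (u k - u n) ^+ 2 <= d n) ->
  exists l, forall n, (l - u n) ^+ 2 <= d n.
Proof.
move=> d0 H.
have H' n k : (n <= k)%N -> `|u k - u n| <= Num.sqrt (d n).
  by move=> nk; rewrite -sqrtr_sqr ler_wsqrtr// H.
have s0 : Num.sqrt (d n) @[n --> \oo] --> 0.
  rewrite -[X in _ --> X](sqrtr0 R).
  exact: (continuous_cvg _ (@sqrt_continuous R 0)).
have : cvg (u @ \oo).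
  apply/cauchy_cvgP/cauchy_exP => e e0.
  have /cvgrPdist_lt/(_ e e0) [n _ Hn] := s0.
  exists (u n); exists n => // k nk /=.
  rewrite /ball/= distrC (le_lt_trans (H' n k nk))//.
  by have := Hn n (leqnn n); rewrite /= sub0r normrN ger0_norm// sqrtr_ge0.
move=> /cvg_ex[l ul]; exists l => n.
have c : u k - u n @[k --> \oo] --> l - u n by apply: cvgB => //; exact: cvg_cst.
apply: (cvgr_to_le (cvgM c c)).
by exists n => // k /= nk; exact: H.
Qed.

Lemma sqr_cmod_ReIm (z : R[i]) : cmod z ^+ 2 = complex.Re z ^+ 2 + complex.Im z ^+ 2.
Proof. by case: z => a b; exact: sqr_cmod. Qed.

Lemma complex_cauchy_limit (z : nat -> R[i]) (d : nat -> R) : d @ \oo --> 0 ->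
  (forall n k, (n <= k)%N -> cmod (z k - z n) ^+ 2 <= d n) ->
  exists l, forall n, cmod (l - z n) ^+ 2 <= 2 * d n.
Proof.
move=> d0 H.
have [|a ad] := @real_cauchy_limit (fun n => complex.Re (z n)) d d0.
  move=> n k /H; rewrite sqr_cmod_ReIm !raddfB/= => H'.
  by apply: le_trans H'; rewrite lerDl sqr_ge0.
have [|b bd] := @real_cauchy_limit (fun n => complex.Im (z n)) d d0.
  move=> n k /H; rewrite sqr_cmod_ReIm !raddfB/= => H'.
  by apply: le_trans H'; rewrite lerDr sqr_ge0.
exists (Complex a b) => n; rewrite sqr_cmod_ReIm !raddfB/=.
by have := ad n; have := bd n; lra.
Qed.

End Limits.

(** * The form domain without a lower bound *)

Section GlidingHump.
Context {R : realType} {X : choiceType}.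
Variable G : magnetic_graph R X.
Variable alpha : R.
Hypothesis alpha1 : alpha < 1.
Hypothesis hq : form_small G 2 alpha.
Implicit Types (f g h : X -> R[i]).

Local Notation m := (vertex_measure G).
Local Notation P := (pos_energy G 2).
Local Notation N := (mass_norm G 2).
Local Notation S := (deg_norm G 2).

Section Unbounded.
Hypothesis unbounded : forall K : R, 0 <= K ->
  exists f, Cc f /\ K * form_norm G f < S f.

(** Scaling a function that violates the bound gives [k] with small form norm and
    degree norm [L]. By the parallelogram inequality one of [g + k] and [g - k]
    has degree norm at least [L], whatever [g] is. *)
Lemma hump g (e L : R) : Cc g -> 0 < e -> 0 < L -> exists g',
  [/\ Cc g', form_norm G (g' \- g) <= e & L <= S g'].
Proof.
move=> gc e0 L0.
have [h [hc Lh]] := unbounded (divr_ge0 (ltW L0) (ltW e0)).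
have Sh : 0 < S h.
  by apply: le_lt_trans Lh; rewrite mulr_ge0 ?form_norm_ge0// divr_ge0 ?ltW.
pose c := Num.sqrt (L / S h); pose k := scale c h.
have c2 : c ^+ 2 = L / S h by rewrite sqr_sqrtr// divr_ge0 ?ltW.
have kc : Cc k by exact: Cc_scale.
have Sk : S k = L by rewrite deg_norm2Z// c2 divfK// gt_eqF.
have Bk : form_norm G k <= e.
  rewrite form_normZ// c2 mulrAC ler_pdivrMr//.
  by move: Lh; rewrite mulrAC ltr_pdivrMr// [e * _]mulrC => /ltW.
have : L <= S (g \+ k) \/ L <= S (g \- k).
  have /CcD/(_ (CcB kc gc)) := CcD gc kc => _.
  have := deg_norm2D G (CcD gc kc) (CcB kc gc).
  have -> : (g \+ k) \+ (k \- g) = scale 2 k.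
    apply/funext => x; rewrite /scale.
    have -> : Complex 2 0 = 2 :> R[i].
      by apply/eqP; rewrite eq_complex/= addr0 !eqxx.
    by rewrite /=; ring.
  rewrite deg_norm2Z// -(scaleN1 g k) deg_norm2Z ?sqrrN ?expr1n ?mul1r//; last exact: CcB.
  rewrite Sk; have [H|H] := leP L (S (g \+ k)); first by left.
  right; lra.
move=> [H|H].
- exists (g \+ k); split=> //; first exact: CcD.
  by rewrite (_ : _ \- g = k)//; apply/funext => x /=; rewrite addrC addKr.
- exists (g \- k); split=> //; first exact: CcB.
  rewrite (_ : _ \- g = scale (-1) k).
    by rewrite form_normZ// sqrrN expr1n mul1r.
  have -> : k = k \- (fun=> 0) by apply/funext => x /=; rewrite subr0.
  by rewrite scaleN1; apply/funext => x /=; rewrite subr0 sub0r addrC addKr.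
Qed.

(** Each step of the quasi-triangle inequality of the form norm costs a factor
    [2], so the ratio of the bounds on the humps has to be less than [1/2]. *)
Let r : R := 8^-1.

(** The bounds [K n] dominate the degree on the supports of the partial sums
    [g 1], ..., [g n]; the next hump is small relative to [K n], so that its degree
    norm on these supports is small although its total degree norm is large. *)
Lemma hump_sequence : exists (g : nat -> X -> R[i]) (K : nat -> R),
  [/\ forall n, Cc (g n), forall n, 1 <= K n <= K n.+1,
      forall n, form_norm G (g n.+1 \- g n) <= r ^+ n / K n,
      forall n, n.+1%:R <= S (g n.+1) &
      forall n x, g n.+1 x != 0 -> Degpos G x <= K n.+1].
Proof.
pose good (n : nat) (s s' : (X -> R[i]) * R) :=
  [/\ Cc s'.1, s.2 <= s'.2,
    form_norm G (s'.1 \- s.1) <= r ^+ n / s.2, n.+1%:R <= S s'.1 &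
    forall x, s'.1 x != 0 -> Degpos G x <= s'.2].
have step (ns : nat * ((X -> R[i]) * R)) : exists s',
    Cc ns.2.1 -> 1 <= ns.2.2 -> good ns.1 ns.2 s'.
  case: ns => n [g K] /=; have [gc|] := pselect (Cc g); last by exists (g, K).
  have [K1|] := pselect (1 <= K); last by exists (g, K).
  have e0 : 0 < r ^+ n / K by rewrite divr_gt0 ?exprn_gt0 ?invr_gt0//; lra.
  have [g' [g'c Bg' Sg']] := hump gc e0 (ltr0Sn _ n).
  have [c c0 Hc] := finite_bound (g'c : finite_set _) (Degpos_ge0 G).
  exists (g', K + c) => _ _; split=> //=; first lra.
  by move=> x /Hc; lra.
have [next nextP] := choice step.
pose s := fix s n := if n is n'.+1 then next (n', s n') else ((fun=> 0 : R[i]) : X -> R[i], 1 : R).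
have sc n : Cc (s n).1 /\ 1 <= (s n).2.
  elim: n => [|n [IHc IH1]]; last first.
    by have [? /(le_trans IH1)] := nextP (n, s n) IHc IH1.
  split=> //=; rewrite /Cc/= (_ : [set _ | _] = set0)//.
  by apply/seteqP; split=> x //=; rewrite eqxx.
have sP n : good n (s n) (s n.+1) by have [? ?] := sc n; exact: nextP (n, s n) _ _.
exists (fun n => (s n).1), (fun n => (s n).2); split=> n.
- by have [] := sc n.
- by have [_ ->] := sc n; have [] := sP n.
all: by have [] := sP n.
Qed.

(** The pointwise limit [f] of the partial sums lies in the form domain. On the
    support of [g n] the degree is at most [K n], so there the degree norm of
    [f - g n] stays bounded while that of [g n] is at least [n]; hence the degree
    norm of [f] is infinite. *)
Lemma unbounded_form_domain : exists f, form_domain G f /\ ~ ell2 (deg_plus G) f.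
Proof.
have [g [K [gc KP Bg Sg Kg]]] := hump_sequence.
have K1 n : 1 <= K n by have /andP[] := KP n.
have Kmon n : K n <= K n.+1 by have /andP[] := KP n.
have r0 : 0 < r by rewrite invr_gt0.
have K0 n : 0 < K n by apply: lt_le_trans (K1 n).
have B n j : form_norm G (g (n + j)%N \- g n) <= 4 * (r ^+ n / K n).
  elim: j n => [|j IH] n.
    have -> : g (n + 0)%N \- g n = scale 0 (g 0%N).
      apply/funext => x; rewrite addn0 /scale/= subrr.
      by rewrite (_ : Complex 0 0 = 0) ?mul0r.
    rewrite form_normZ// expr0n mul0r mulr_ge0// divr_ge0 ?exprn_ge0// ltW//.
  have -> : g (n + j.+1)%N \- g n = (g (n.+1 + j)%N \- g n.+1) \+ (g n.+1 \- g n).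
    by apply/funext => x /=; rewrite addrA subrK addnS addSn.
  apply: le_trans (form_normD G (CcB (gc _) (gc _)) (CcB (gc _) (gc _))) _.
  have := IH n.+1; have := Bg n.
  have : r ^+ n.+1 / K n.+1 <= 8^-1 * (r ^+ n / K n).
    rewrite exprS -mulrA ler_pM2l// ler_pM2l ?exprn_gt0//.
    by rewrite lef_pV2 ?posrE.
  have : 0 <= r ^+ n / K n by rewrite divr_ge0 ?exprn_ge0// ltW.
  lra.
have rK n : r ^+ n / K n <= r ^+ n.
  by rewrite ler_pdivrMr// ler_peMr// exprn_ge0// ltW.
have rcvg c : (fun n => c * r ^+ n) @ \oo --> (0 : R).
  by apply: cvg_geometric; rewrite ger0_norm ?ltW// /r invf_lt1// ltr1n.
have Nx n k x : (n <= k)%N -> cmod (g k x - g n x) ^+ 2 <= 4 / m x * (r ^+ n / K n).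
  move=> /subnKC <-; rewrite mulrAC ler_pdivlMr ?vertex_measure_gt0//.
  apply: le_trans (B n (k - n)%N); rewrite -lee_fin.
  apply: (@le_trans _ _ (N (g (n + (k - n))%N \- g n))%:E).
    rewrite mass_norm_wsum; last exact: CcB.
    apply: le_trans (le_wsum_set (vertex_measure_ge0 G) [set x] _).
    by rewrite /wsum esum_set1// wsum_term_ge0//; exact: vertex_measure_ge0.
  by rewrite lee_fin lerDr pos_energy_ge0.
have lim x : exists l, forall n, cmod (l - g n x) ^+ 2 <= 2 * (4 / m x * r ^+ n).
  apply: complex_cauchy_limit; first exact: rcvg.
  move=> n k /Nx => H; apply: le_trans (H x) _; apply: ler_wpM2l => //.
  by rewrite divr_ge0// vertex_measure_ge0.
have [f fP] := choice lim.
have Nf n : (wsum m setT (f \- g n)%R <= (8 * (r ^+ n / K n))%:E)%E.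
  apply: (@wsum_le_fin _ _ _ (vertex_measure_ge0 G)) => A fA.
  apply/lee_addgt0Pr => e e0.
  pose a : R := \sum_(x <- fset_set A) 1.
  have /cvgrPdist_le/(_ e e0) [k0 _ Hk] := rcvg (16 * a).
  pose k := maxn k0 n; have nk : (n <= k)%N by rewrite leq_maxr.
  have -> : (f \- g n)%R = ((g k \- g n) \+ (f \- g k))%R.
    by apply/funext => x /=; ring.
  apply: le_trans (wsumD_le (vertex_measure_ge0 G) _ _ _) _; apply: leeD.
    have -> : (8 * (r ^+ n / K n))%:E = (2%:E * (4 * (r ^+ n / K n))%:E)%E.
      by rewrite -EFinM; congr (_%:E); ring.
    rewrite lee_wpmul2l ?lee_fin//; apply: le_trans (le_wsum_set (vertex_measure_ge0 G) _ _) _.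
    rewrite -mass_norm_wsum; last exact: CcB.
    rewrite lee_fin; have := B n (k - n)%N; rewrite subnKC//; apply: le_trans.
    by rewrite lerDr pos_energy_ge0.
  apply: (@le_trans _ _ (16 * a * r ^+ k)%:E); last first.
    have := Hk k; rewrite /= leq_maxl => /(_ isT).
    by rewrite sub0r normrN lee_fin; apply: le_trans; exact: ler_norm.
  rewrite (_ : 16 * a * r ^+ k = 2 * (a * (8 * r ^+ k))); last by ring.
  rewrite EFinM lee_wpmul2l ?lee_fin//.
  rewrite /wsum esum_fset//; last by move=> x _; apply: wsum_term_ge0; exact: vertex_measure_ge0.
  rewrite fsumEFin// lee_fin fsbig_finite// /a mulr_suml; apply: ler_sum => x _.
  rewrite mul1r; apply: (@le_trans _ _ (2 * (4 / m x * r ^+ k) * m x)).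
    by apply: ler_wpM2r; [exact: vertex_measure_ge0|exact: fP].
  rewrite le_eqVlt; apply/orP; left; apply/eqP; field.
  by rewrite gt_eqF// vertex_measure_gt0.
exists f; split.
- apply: (@form_domainI _ _ G alpha _ hq f g (fun n => 8 * r ^+ n)) => //.
  + move=> n; rewrite wsumBC; apply: le_trans (Nf n) _.
    by rewrite lee_fin ler_pM2l.
  + move=> n k; wlog nk : n k / (n <= k)%N => [H|].
      have [|/ltnW kn] := leqP n k; first exact: H.
      by rewrite form_normBC// addrC; exact: H.
    rewrite form_normBC//; have := B n (k - n)%N; rewrite subnKC// => H.
    have := rK n; have : 0 <= r ^+ n by rewrite exprn_ge0// ltW.
    have : 0 <= r ^+ k by rewrite exprn_ge0// ltW.
    lra.
- move=> fdeg; rewrite /ell2/= -[X in (X < _)%E]/(wsum (deg_plus G) setT f) in fdeg.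
  have dfin : wsum (deg_plus G) setT f \is a fin_num.
    by rewrite ge0_fin_numE// wsum_ge0//; exact: deg_plus_ge0.
  pose c : R := fine (wsum (deg_plus G) setT f).
  have Sle n : S (g n.+1) <= 2 * c + 16.
    pose A := [set x | g n.+1 x != 0].
    rewrite -lee_fin deg_norm_wsum//.
    have -> : wsum (deg_plus G) setT (g n.+1) = wsum (deg_plus G) A (g n.+1).
      rewrite [RHS]/wsum esum_mkcond; apply: eq_esum => x _.
      case: ifPn => //; rewrite notin_setE /A/= => /negP; rewrite negbK => /eqP ->.
      by rewrite cmod0 expr0n mul0r.
    have -> : g n.+1 = (f \+ (g n.+1 \- f))%R.
      by apply/funext => x /=; rewrite addrC subrK.
    apply: le_trans (wsumD_le (deg_plus_ge0 G) _ _ _) _.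
    rewrite (_ : 16 = 2 * 8); last by ring.
    rewrite (EFinD (2 * c)) !EFinM leeD//.
      rewrite lee_wpmul2l ?lee_fin// /c fineK//.
      exact: le_wsum_set (deg_plus_ge0 G) _ _.
    rewrite lee_wpmul2l ?lee_fin// wsumBC.
    apply: (@le_trans _ _ ((K n.+1)%:E * wsum m A (f \- g n.+1)%R)%E).
      apply: wsum_le_weight; [exact: ltW|exact: vertex_measure_ge0|].
      by move=> x Ax; rewrite deg_plusE ler_wpM2r ?vertex_measure_ge0// Kg.
    apply: (@le_trans _ _ ((K n.+1)%:E * (8 * (r ^+ n.+1 / K n.+1))%:E)%E).
      apply: lee_wpmul2l; first by rewrite lee_fin ltW.
      exact: le_trans (le_wsum_set (vertex_measure_ge0 G) _ _) (Nf _).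
    rewrite -EFinM lee_fin mulrCA (mulrCA (K _)) mulfV ?gt_eqF// mulr1.
    rewrite ler_piMr// exprn_ile1//; first exact: ltW.
    by rewrite /r invf_le1// ler1n.
  have := archi_boundP (_ : 0 <= 2 * c + 16).
  have c0 : 0 <= c by rewrite fine_ge0// wsum_ge0//; exact: deg_plus_ge0.
  move=> /(_ ltac:(lra)); rewrite ltNge => /negP; apply.
  apply: le_trans (Sle (Num.bound (2 * c + 16))); apply: le_trans (Sg _).
  by rewrite ler_nat.
Qed.

End Unbounded.

(** The closed graph theorem for the inclusion of the form domain in the weighted
    [l^2] space, in the form needed here. *)
Lemma bounded_of_form_domain :
  form_domain G = ell2 (deg_plus G) `&` ell2 m ->
  exists2 K : R, 0 <= K & forall f, Cc f -> S f <= K * (P f + N f).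
Proof.
move=> E; apply: contrapT => H.
have [K K0|f [fD fdeg]] := unbounded_form_domain.
  apply: contrapT => H'; apply: H; exists K => // f fc.
  by rewrite leNgt; apply/negP => Kf; apply: H'; exists f.
by rewrite E in fD; case: fD.
Qed.

End GlidingHump.

(** * The characterization of magnetic sparseness *)

Theorem theorem3p1 (R : realType) (X : choiceType) (G : magnetic_graph R X)
    (alpha p : R) (halpha0 : 0 < alpha) (halpha1 : alpha < 1) (hp : 1 <= p)
    (hq : form_small G p alpha) :
  let i := exists a k : R, [/\ 0 <= a, 0 <= k & magnetic_sparse G 1 a k] in
  let i' := exists a' k' : R, [/\ 0 <= a', 0 <= k' & magnetic_sparse G p a' k'] in
  let ii := exists a k : R, [/\ 0 < a, a < 1, 0 <= k & Deg_bound G p a k] in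
  let iii :=
    form_domain G = ell2 (deg_plus G) `&` ell2 (vertex_measure G) in
  let D (a : R) := 2 `^ (1 - p) * (p ^+ 2 + 1) `^ (p / 2) * (1 + a) `^ p in
  [/\ (i <-> i') /\ (i <-> ii),
      p = 2 -> [/\ i <-> iii, i' <-> iii & ii <-> iii],
      forall a k : R, 0 <= a -> 0 <= k -> magnetic_sparse G 1 a k ->
        let a' := (D a - alpha) / (1 - alpha) in
        exists k' : R,
          [/\ 0 <= a', 0 <= k', magnetic_sparse G p a' k' &
              k = 0 -> (forall x, 0 <= potential G x) -> k' = 0] &
      forall a k : R, 0 <= a -> 0 <= k -> magnetic_sparse G 1 a k ->
        let atilde := 1 - (1 - alpha) / (D a - alpha) in
        exists ktilde : R,
          [/\ 0 < atilde, atilde < 1, 0 <= ktilde, Deg_bound G p atilde ktilde &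
              k = 0 -> (forall x, 0 <= potential G x) -> ktilde = 0]].
Proof.
move=> i i' ii iii D.
have p0 : 0 < p by apply: lt_le_trans hp.
have sparse_Deg (a k : R) : 0 <= a -> 0 <= k -> magnetic_sparse G 1 a k ->
    let atilde := 1 - (1 - alpha) / (D a - alpha) in
    exists ktilde : R,
      [/\ 0 < atilde, atilde < 1, 0 <= ktilde, Deg_bound G p atilde ktilde &
          k = 0 -> (forall x, 0 <= potential G x) -> ktilde = 0].
  move=> a0 k0 sp atilde.
  have D1 : 1 < D a := hardy_const_gt1 hp a0.
  have [kt [kt0 HB Hz]] := Deg_bound_of_deg_norm_le p0 halpha0 halpha1 D1
    (mulr_ge0 (ltW p0) k0) hq (fun f => deg_norm_le_of_sparse hp a0 k0 sp).
  exists kt; split=> //.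
  - by rewrite subr_gt0 ltr_pdivrMr; lra.
  - by rewrite gtrDl oppr_lt0 divr_gt0//; lra.
  - by move=> k00; apply: Hz; rewrite k00 mulr0.
have i_ii : i -> ii.
  move=> [a [k [a0 k0 /(sparse_Deg _ _ a0 k0)[kt [? ? ? ? _]]]]].
  by exists (1 - (1 - alpha) / (D a - alpha)), kt.
have ii_i' : ii -> i'.
  move=> [a [k [a0 a1 k0 HB]]].
  exists ((1 - a)^-1 - 1), (k / (1 - a)); split.
  - by rewrite subr_ge0 invf_ge1 ?subr_gt0// gerBl ltW.
  - by rewrite divr_ge0// subr_ge0 ltW.
  - exact: sparse_of_Deg_bound (ltW a0) a1 k0 HB.
have i'_i : i' -> i.
  move=> [a [k [a0 k0 /(magnetic_sparse1 hp a0) sp]]].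
  exists ((1 + a) * 2 `^ (p - 1) - 1), k; split=> //.
  have : 1 <= 2 `^ (p - 1) :> R by rewrite -[leLHS](powRr0 2) ler_powR ?subr_ge0// ler1n.
  nra.
split=> //.
- split; split=> h.
  + exact: ii_i' (i_ii h).
  + exact: i'_i h.
  + exact: i_ii h.
  + exact: i'_i (ii_i' h).
- move=> p2; suff [ii_iii iii_ii] : ii <-> iii.
    split; split=> h.
    + exact: ii_iii (i_ii h).
    + exact: i'_i (ii_i' (iii_ii h)).
    + exact: ii_iii (i_ii (i'_i h)).
    + exact: ii_i' (iii_ii h).
    + exact: ii_iii h.
    + exact: iii_ii h.
  rewrite p2 in hq p0; rewrite /ii p2; split.
    move=> [a [k [a0 a1 k0 HB]]].
    have [K K0 HK] := deg_norm_le_of_Deg_bound p0 a0 a1 k0 HB.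
    rewrite /iii; apply/seteqP; split.
      exact: form_domain_sub halpha1 hq K K0 HK.
    exact: ell2_sub_form_domain halpha1 hq.
  move=> /(bounded_of_form_domain halpha1 hq)[K K0 HK].
  have K2 : 1 < K + 2 by lra.
  (* [K + 2] instead of [K] only to have a constant larger than [1] *)
  have [|kt [kt0 HB _]] := @Deg_bound_of_deg_norm_le _ _ G 2 alpha (K + 2) K
    p0 halpha0 halpha1 K2 K0 hq.
    move=> f fc; have := HK f fc; have := pos_energy_ge0 G 2 f; lra.
  exists (1 - (1 - alpha) / (K + 2 - alpha)), kt; split=> //.
  - by rewrite subr_gt0 ltr_pdivrMr; lra.
  - by rewrite gtrDl oppr_lt0 divr_gt0//; lra.
- move=> a k a0 k0 sp a'.
  have D1 : 1 < D a := hardy_const_gt1 hp a0.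
  have [kt [at0 at1 kt0 HB Hz]] := sparse_Deg a k a0 k0 sp.
  set l := 1 - (1 - alpha) / (D a - alpha) in at0 at1 HB.
  exists (kt / (1 - l)); split.
  - by rewrite divr_ge0; lra.
  - by rewrite divr_ge0//; lra.
  - apply: magnetic_sparse_le (sparse_of_Deg_bound p0 (ltW at0) at1 kt0 HB).
    have -> : (1 - l)^-1 = a' by rewrite /l /a'; field; apply/andP; split; lra.
    lra.
  - by move=> k00 q0; rewrite Hz// mul0r.
Qed.
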